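(* Let $K$ be a field of characteristic zero and $n\ge 2$. Identifying the elements of the free metabelian Lie algebra $F_n$ with their images under the embedding $\delta:F_n\to (KU_n)\,\mathrm{wr}\,(KV_n)$ in the abelian wreath product, the $K[X_n]^{S_n}$-module $(F_n')^{S_n}$ is generated by the polynomials \[ h_{ij}(U_n,X_n)=j\,\varepsilon_i(U_n,X_n)\,e_j(X_n)-i\,\varepsilon_j(U_n,X_n)\,e_i(X_n),\qquad 1\le i<j\le n. \]
   Context: $K$ is a field of characteristic zero, $n\ge 2$, $X_n=\{x_1,\dots,x_n\}$, and $K[X_n]$ is the commutative polynomial algebra. $F_n=L_n/L_n''$ is the free metabelian Lie algebra over $K$ freely generated by $X_n$, where $L_n$ is the free Lie algebra on $X_n$ and $L_n''=[[L_n,L_n],[L_n,L_n]]$; $F_n'=[F_n,F_n]$ is its commutator ideal. $F_n'$ is a right $K[X_n]$-module via $f\,p(x_1,\dots,x_n)=f\,p(\mathrm{ad}\,x_1,\dots,\mathrm{ad}\,x_n)$ for $f\in F_n'$, $p\in K[X_n]$, where $f\,\mathrm{ad}\,x=[f,x]$. Abelian wreath product: let $KU_n$ and $KV_n$ be abelian Lie algebras with bases $U_n=\{u_1,\dots,u_n\}$ and $V_n=\{v_1,\dots,v_n\}$, and let $W_n$ be the free right $K[X_n]$-module with free generators $u_1,\dots,u_n$. As a vector space $(KU_n)\,\mathrm{wr}\,(KV_n)=W_n\oplus KV_n$, with Lie bracket determined by $[W_n,W_n]=0$, $[V_n,V_n]=0$, $[u_ip(X_n),v_j]=u_ip(X_n)x_j$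 for $p\in K[X_n]$. The Lie algebra homomorphism $\delta:F_n\to (KU_n)\,\mathrm{wr}\,(KV_n)$ defined by $\delta(x_i)=u_i+v_i$ is injective; it maps $F_n'$ into $W_n$ compatibly with the $K[X_n]$-module structures, with $\delta([x_i,x_j]\,p)=(u_ix_j-u_jx_i)p$. The symmetric group $S_n$ acts by permuting indices: on $F_n$ and on $K[X_n]$ by $\sigma(x_i)=x_{\sigma(i)}$ (extended to algebra automorphisms), and on the wreath product by $\sigma(u_ip)=u_{\sigma(i)}\sigma(p)$, $\sigma(v_i)=v_{\sigma(i)}$. The superscript $S_n$ denotes the set of invariants; $(F_n')^{S_n}=F_n'\cap F_n^{S_n}$ is a $K[X_n]^{S_n}$-module. Elements of $W_n$ are written as polynomials in the commuting variables $U_n\cup X_n$ which are linear homogeneous in $U_n$. For $1\le q\le n$, $e_q(X_n)=\sum_{1\le j_1<\cdots<j_q\le n}x_{j_1}\cdots x_{j_q}$ is the $q$-th elementary symmetric polynomial. For $0\le q\le n-1$, \[ \varepsilon_{q+1}(U_n,X_n)=\sum_{i=1}^n u_i\sum x_{j_1}\cdots x_{j_q}, \] where the inner sum runs over all $1\le j_1<\cdots<j_q\le n$ with $i\ne j_1,\dots,j_q$ (so $\varepsilon_1=u_1+\cdots+u_n$). *)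

(* Defs.v *)
(* MathComp, with the classical axioms of mathcomp.classical and the
   polynomial algebras of multinomials. *)
From HB Require Import structures.
From mathcomp Require Import all_boot all_order all_algebra perm.
From mathcomp Require Import boolp classical_sets.
From mathcomp Require Import mpoly.
From mathcomp Require Import ring.
Set Implicit Arguments.
Unset Strict Implicit.
Unset Printing Implicit Defensive.
Import GRing.Theory.
Local Open Scope ring_scope.
Local Open Scope quotient_scope.
Local Open Scope classical_set_scope.

HB.mixin Record isLieAlgebra (K : fieldType) L of GRing.Lmodule K L := {
  lie : L -> L -> L;
  lieDl : forall x y z, lie (x + y) z = lie x z + lie y z;
  lieZl : forall (a : K) x z, lie (a *: x) z = a *: lie x z;
  lieDr : forall x y z, lie z (x + y) = lie z x + lie z y;
  lieZr : forall (a : K) x z, lie z (a *: x) = a *: lie z x;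
  liexx : forall x, lie x x = 0;
  lie_jacobi : forall x y z,
    lie (lie x y) z + lie (lie y z) x + lie (lie z x) y = 0
}.

#[short(type="lieAlgType")]
HB.structure Definition LieAlgebra (K : fieldType) :=
  {L of isLieAlgebra K L & GRing.Lmodule K L}.

Definition lie_morphism (K : fieldType) (A B : lieAlgType K) (f : A -> B) :=
  [/\ forall x y, f (x + y) = f x + f y,
      forall (a : K) x, f (a *: x) = a *: f x
    & forall x y, f (lie x y) = lie (f x) (f y)].

Section LieTheory.
Variables (K : fieldType) (L : lieAlgType K).
Implicit Types (x y z : L) (S : set L).

Definition lspan S : set L :=
  [set v | exists m (c : 'I_m -> K) (g : 'I_m -> L),
     (forall k, S (g k)) /\ v = \sum_(k < m) c k *: g k].

Definition lie_bracket_space (A B : set L) : set L :=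
  lspan [set z | exists x y, [/\ A x, B y & z = lie x y]].

(* [derived] is L' = [L, L] and [derived2] is L'' = [L', L']. *)
Definition derived : set L := lie_bracket_space setT setT.
Definition derived2 : set L := lie_bracket_space derived derived.

Definition metabelian := forall x y z t, lie (lie x y) (lie z t) = 0 :> L.

Lemma lspan_sub S x : S x -> lspan S x.
Proof.
by move=> Sx; exists 1%N, (fun=> 1), (fun=> x); rewrite big_ord1 scale1r.
Qed.

Lemma lspan0 S : lspan S 0.
Proof.
exists 0%N, (fun=> 0), (fun=> 0); split; last by rewrite big_ord0.
by case=> i; rewrite ltn0.
Qed.

Lemma lspanD S x y : lspan S x -> lspan S y -> lspan S (x + y).
Proof.
move=> [m [c [g [Sg ->]]]] [p [d [h [Sh ->]]]].
exists (m + p)%N, (fun k => match split k with inl i => c i | inr i => d i end),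
  (fun k => match split k with inl i => g i | inr i => h i end).
split; first by move=> k /=; case: (split k) => i.
rewrite big_split_ord /=; congr (_ + _); apply: eq_bigr => i _.
  by rewrite -[lshift _ _]/(unsplit (inl i)) unsplitK.
by rewrite -[rshift _ _]/(unsplit (inr i)) unsplitK.
Qed.

Lemma lspanZ S a x : lspan S x -> lspan S (a *: x).
Proof.
move=> [m [c [g [Sg ->]]]]; exists m, (fun k => a * c k), g; split=> //.
by rewrite scaler_sumr; apply: eq_bigr => k _; rewrite scalerA.
Qed.

Lemma lspan_ind S (P : L -> Prop) : P 0 ->
  (forall x y, P x -> P y -> P (x + y)) -> (forall a x, S x -> P (a *: x)) ->
  forall x, lspan S x -> P x.
Proof.
move=> P0 PD PZ _ [m [c [g [Sg ->]]]].
by apply: (big_ind P) => // k _; apply: PZ.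
Qed.

Lemma lie0l x : lie 0 x = 0 :> L.
Proof. by rewrite -(scale0r 0) lieZl !scale0r. Qed.

Lemma lie0r x : lie x 0 = 0 :> L.
Proof. by rewrite -(scale0r 0) lieZr !scale0r. Qed.

Lemma lieC x y : lie x y = - lie y x.
Proof.
apply/eqP; rewrite -addr_eq0; apply/eqP.
by have := liexx (x + y); rewrite lieDl !lieDr !liexx add0r addr0.
Qed.

Lemma lieNl x y : lie (- x) y = - lie x y.
Proof. by rewrite -scaleN1r lieZl scaleN1r. Qed.

Lemma lie_leibniz x y z : lie (lie x y) z = lie (lie x z) y + lie x (lie y z).
Proof.
have /eqP := lie_jacobi x y z; rewrite -addrA addr_eq0 => /eqP ->.
by rewrite opprD addrC (lieC z x) lieNl opprK (lieC x (lie y z)).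
Qed.

Lemma derived_lie x y : derived (lie x y).
Proof. by apply: lspan_sub; exists x, y. Qed.

Lemma derived2_lie x z : derived2 x -> derived2 (lie x z).
Proof.
apply: (lspan_ind (P := fun x => derived2 (lie x z))).
- by rewrite lie0l; apply: lspan0.
- by move=> a b Ha Hb; rewrite lieDl; apply: lspanD.
- move=> a _ [u [v [Du Dv ->]]]; rewrite lieZl; apply: lspanZ.
  rewrite lie_leibniz; apply: lspanD; apply: lspan_sub.
    by exists (lie u z), v; split=> //; apply: derived_lie.
  by exists u, (lie v z); split=> //; apply: derived_lie.
Qed.

End LieTheory.

Arguments derived {K} L.
Arguments derived2 {K} L.
Arguments metabelian {K} L.

Record lie_ideal (K : fieldType) (L : lieAlgType K) := LieIdeal {
  ideal_set :> L -> Prop;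
  ideal0 : ideal_set 0;
  idealD : forall x y, ideal_set x -> ideal_set y -> ideal_set (x + y);
  idealZ : forall a x, ideal_set x -> ideal_set (a *: x);
  ideal_lie : forall x z, ideal_set x -> ideal_set (lie x z)
}.

Section LieQuotient.
Variables (K : fieldType) (L : lieAlgType K) (I : lie_ideal L).

Definition ideal_rel : rel L := fun x y => `[< I (x - y) >].

Lemma idealN x : I x -> I (- x).
Proof. by rewrite -scaleN1r; apply: idealZ. Qed.

Lemma ideal_rel_equiv : equiv_class_of ideal_rel.
Proof.
split.
- by move=> x; apply/asboolP; rewrite subrr; apply: ideal0.
- move=> x y; apply/asboolP/asboolP => /idealN; by rewrite opprB.
- move=> y x z /asboolP xy /asboolP yz; apply/asboolP.
  by rewrite -(subrK y x) -addrA; apply: idealD.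
Qed.

Canonical ideal_equiv := EquivRelPack ideal_rel_equiv.
Definition lie_quot := {eq_quot ideal_equiv}.
HB.instance Definition _ := Choice.on lie_quot.
HB.instance Definition _ : EqQuotient _ _ lie_quot := EqQuotient.on lie_quot.

Definition lie_quot_pi (x : L) : lie_quot := \pi x.

Lemma lie_quot_eq x y : I (x - y) <-> lie_quot_pi x = lie_quot_pi y.
Proof.
split=> [h|/eqquotP/asboolP //].
by apply/eqquotP/asboolP.
Qed.

Lemma lie_quot_repr (a : lie_quot) : lie_quot_pi (repr a) = a.
Proof. exact: reprK. Qed.

Lemma lie_quot_ind (P : lie_quot -> Prop) :
  (forall x, P (lie_quot_pi x)) -> forall a, P a.
Proof. by move=> h a; rewrite -(lie_quot_repr a). Qed.

Definition lq_add (a b : lie_quot) := lie_quot_pi (repr a + repr b).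
Definition lq_opp (a : lie_quot) := lie_quot_pi (- repr a).
Definition lq_scale (c : K) (a : lie_quot) := lie_quot_pi (c *: repr a).
Definition lq_lie (a b : lie_quot) := lie_quot_pi (lie (repr a) (repr b)).

Lemma lq_addE x y : lq_add (lie_quot_pi x) (lie_quot_pi y) = lie_quot_pi (x + y).
Proof.
apply/lie_quot_eq; rewrite opprD addrACA.
by apply: idealD; apply/lie_quot_eq; rewrite lie_quot_repr.
Qed.

Lemma lq_oppE x : lq_opp (lie_quot_pi x) = lie_quot_pi (- x).
Proof.
apply/lie_quot_eq; rewrite -opprD; apply: idealN.
by apply/lie_quot_eq; rewrite lie_quot_repr.
Qed.

Lemma lq_scaleE c x : lq_scale c (lie_quot_pi x) = lie_quot_pi (c *: x).
Proof.
apply/lie_quot_eq; rewrite -scalerBr; apply: idealZ.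
by apply/lie_quot_eq; rewrite lie_quot_repr.
Qed.

Lemma lq_lieE x y : lq_lie (lie_quot_pi x) (lie_quot_pi y) = lie_quot_pi (lie x y).
Proof.
set x' := repr (lie_quot_pi x); set y' := repr (lie_quot_pi y).
have Ix : I (x' - x) by apply/lie_quot_eq; rewrite lie_quot_repr.
have Iy : I (y' - y) by apply/lie_quot_eq; rewrite lie_quot_repr.
apply/lie_quot_eq; rewrite -/x' -/y'.
have -> : lie x' y' - lie x y = lie (x' - x) y' - lie (y' - y) x.
  rewrite !lieDl !lieNl (lieC y' x) (lieC y x) opprK opprD opprK.
  by rewrite addrA subrK.
by apply: idealD; [|apply: idealN]; apply: ideal_lie.
Qed.

Let lqE := (lq_addE, lq_oppE, lq_scaleE, lq_lieE).

Lemma lq_addA : associative lq_add.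
Proof.
by elim/lie_quot_ind=> x; elim/lie_quot_ind=> y; elim/lie_quot_ind=> z;
  rewrite !lqE addrA.
Qed.

Lemma lq_addC : commutative lq_add.
Proof.
by elim/lie_quot_ind=> x; elim/lie_quot_ind=> y; rewrite !lqE addrC.
Qed.

Lemma lq_add0 : left_id (lie_quot_pi 0) lq_add.
Proof. by elim/lie_quot_ind=> x; rewrite !lqE add0r. Qed.

Lemma lq_addN : left_inverse (lie_quot_pi 0) lq_opp lq_add.
Proof. by elim/lie_quot_ind=> x; rewrite !lqE addNr. Qed.

HB.instance Definition _ :=
  GRing.isZmodule.Build lie_quot lq_addA lq_addC lq_add0 lq_addN.

Lemma lq_scaleA a b v : lq_scale a (lq_scale b v) = lq_scale (a * b) v.
Proof. by elim/lie_quot_ind: v => x; rewrite !lqE scalerA. Qed.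

Lemma lq_scale1 : left_id 1 lq_scale.
Proof. by elim/lie_quot_ind=> x; rewrite !lqE scale1r. Qed.

Lemma lq_scaleDr : right_distributive lq_scale +%R.
Proof.
by move=> a; elim/lie_quot_ind=> x; elim/lie_quot_ind=> y;
  rewrite /GRing.add /= !lqE scalerDr.
Qed.

Lemma lq_scaleDl v : {morph lq_scale^~ v : a b / a + b}.
Proof.
by move=> a b; elim/lie_quot_ind: v => x;
  rewrite [RHS]/GRing.add /= !lqE scalerDl.
Qed.

HB.instance Definition _ := GRing.Zmodule_isLmodule.Build K lie_quot
  lq_scaleA lq_scale1 lq_scaleDr lq_scaleDl.

Lemma lq_lieDl (x y z : lie_quot) : lq_lie (x + y) z = lq_lie x z + lq_lie y z.
Proof.
elim/lie_quot_ind: x => x; elim/lie_quot_ind: y => y; elim/lie_quot_ind: z => z.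
by rewrite /GRing.add /= !lqE lieDl.
Qed.

Lemma lq_lieZl (a : K) (x z : lie_quot) : lq_lie (a *: x) z = a *: lq_lie x z.
Proof.
elim/lie_quot_ind: x => x; elim/lie_quot_ind: z => z.
by rewrite /GRing.scale /= !lqE lieZl.
Qed.

Lemma lq_lieDr (x y z : lie_quot) : lq_lie z (x + y) = lq_lie z x + lq_lie z y.
Proof.
elim/lie_quot_ind: x => x; elim/lie_quot_ind: y => y; elim/lie_quot_ind: z => z.
by rewrite /GRing.add /= !lqE lieDr.
Qed.

Lemma lq_lieZr (a : K) (x z : lie_quot) : lq_lie z (a *: x) = a *: lq_lie z x.
Proof.
elim/lie_quot_ind: x => x; elim/lie_quot_ind: z => z.
by rewrite /GRing.scale /= !lqE lieZr.
Qed.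

Lemma lq_liexx (x : lie_quot) : lq_lie x x = 0.
Proof. by elim/lie_quot_ind: x => x; rewrite !lqE liexx. Qed.

Lemma lq_jacobi (x y z : lie_quot) :
  lq_lie (lq_lie x y) z + lq_lie (lq_lie y z) x + lq_lie (lq_lie z x) y = 0.
Proof.
elim/lie_quot_ind: x => x; elim/lie_quot_ind: y => y; elim/lie_quot_ind: z => z.
by rewrite /GRing.add /= !lqE lie_jacobi.
Qed.

HB.instance Definition _ := isLieAlgebra.Build K lie_quot
  lq_lieDl lq_lieZl lq_lieDr lq_lieZr lq_liexx lq_jacobi.

Lemma lie_quot_pi_morphism : lie_morphism lie_quot_pi.
Proof.
by split=> *; rewrite -?lq_addE -?lq_scaleE -?lq_lieE.
Qed.

End LieQuotient.

(* Lie words in the letters x_0, ..., x_{n-1}. *)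
Inductive lterm (K : Type) (n : nat) : Type :=
| LVar of 'I_n
| LZero
| LOpp of lterm K n
| LAdd of lterm K n & lterm K n
| LScale of K & lterm K n
| LLie of lterm K n & lterm K n.
Arguments LVar {K n}.
Arguments LZero {K n}.

HB.instance Definition _ K n := gen_eqMixin (lterm K n).
HB.instance Definition _ K n := gen_choiceMixin (lterm K n).

Section FreeLie.
Variables (K : fieldType) (n : nat).

Fixpoint leval (A : lieAlgType K) (f : 'I_n -> A) (t : lterm K n) : A :=
  match t with
  | LVar i => f i
  | LZero => 0
  | LOpp s => - leval f s
  | LAdd s u => leval f s + leval f u
  | LScale a s => a *: leval f s
  | LLie s u => lie (leval f s) (leval f u)
  end.

(* Two words are identified when they agree under every evaluation in every
   Lie algebra over K. *)
Definition lcong : rel (lterm K n) := fun s t =>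
  `[< forall (A : lieAlgType K) (f : 'I_n -> A), leval f s = leval f t >].

Lemma lcong_equiv : equiv_class_of lcong.
Proof.
split.
- by move=> s; apply/asboolP.
- by move=> s t; apply/asboolP/asboolP => h A f; rewrite h.
- move=> t s u /asboolP st /asboolP tu; apply/asboolP => A f.
  by rewrite st tu.
Qed.

Canonical lcong_equivrel := EquivRelPack lcong_equiv.
Definition free_lie := {eq_quot lcong_equivrel}.
HB.instance Definition _ := Choice.on free_lie.
HB.instance Definition _ : EqQuotient _ _ free_lie := EqQuotient.on free_lie.

Definition free_lie_pi (t : lterm K n) : free_lie := \pi t.

Lemma free_lie_eq s t :
  (forall (A : lieAlgType K) (f : 'I_n -> A), leval f s = leval f t) <->
  free_lie_pi s = free_lie_pi t.
Proof.
split=> [h|/eqquotP/asboolP //].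
by apply/eqquotP/asboolP.
Qed.

Lemma free_lie_repr (a : free_lie) : free_lie_pi (repr a) = a.
Proof. exact: reprK. Qed.

Lemma free_lie_ind (P : free_lie -> Prop) :
  (forall t, P (free_lie_pi t)) -> forall a, P a.
Proof. by move=> h a; rewrite -(free_lie_repr a). Qed.

Definition fl_add (a b : free_lie) := free_lie_pi (LAdd (repr a) (repr b)).
Definition fl_opp (a : free_lie) := free_lie_pi (LOpp (repr a)).
Definition fl_scale (c : K) (a : free_lie) := free_lie_pi (LScale c (repr a)).
Definition fl_lie (a b : free_lie) := free_lie_pi (LLie (repr a) (repr b)).

Lemma leval_repr t (A : lieAlgType K) (f : 'I_n -> A) :
  leval f (repr (free_lie_pi t)) = leval f t.
Proof. by apply: (free_lie_eq _ _).2; rewrite free_lie_repr. Qed.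

Lemma fl_addE s t : fl_add (free_lie_pi s) (free_lie_pi t) = free_lie_pi (LAdd s t).
Proof. by apply/free_lie_eq => A f /=; rewrite !leval_repr. Qed.

Lemma fl_oppE s : fl_opp (free_lie_pi s) = free_lie_pi (LOpp s).
Proof. by apply/free_lie_eq => A f /=; rewrite !leval_repr. Qed.

Lemma fl_scaleE c s : fl_scale c (free_lie_pi s) = free_lie_pi (LScale c s).
Proof. by apply/free_lie_eq => A f /=; rewrite !leval_repr. Qed.

Lemma fl_lieE s t : fl_lie (free_lie_pi s) (free_lie_pi t) = free_lie_pi (LLie s t).
Proof. by apply/free_lie_eq => A f /=; rewrite !leval_repr. Qed.

Let flE := (fl_addE, fl_oppE, fl_scaleE, fl_lieE).

Lemma fl_addA : associative fl_add.
Proof.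
elim/free_lie_ind=> x; elim/free_lie_ind=> y; elim/free_lie_ind=> z.
by rewrite !flE; apply/free_lie_eq => A f /=; rewrite addrA.
Qed.

Lemma fl_addC : commutative fl_add.
Proof.
elim/free_lie_ind=> x; elim/free_lie_ind=> y.
by rewrite !flE; apply/free_lie_eq => A f /=; rewrite addrC.
Qed.

Lemma fl_add0 : left_id (free_lie_pi LZero) fl_add.
Proof.
by elim/free_lie_ind=> x; rewrite !flE; apply/free_lie_eq => A f /=; rewrite add0r.
Qed.

Lemma fl_addN : left_inverse (free_lie_pi LZero) fl_opp fl_add.
Proof.
by elim/free_lie_ind=> x; rewrite !flE; apply/free_lie_eq => A f /=; rewrite addNr.
Qed.

HB.instance Definition _ :=
  GRing.isZmodule.Build free_lie fl_addA fl_addC fl_add0 fl_addN.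

Lemma fl_scaleA a b v : fl_scale a (fl_scale b v) = fl_scale (a * b) v.
Proof.
elim/free_lie_ind: v => x; rewrite !flE.
by apply/free_lie_eq => A f /=; rewrite scalerA.
Qed.

Lemma fl_scale1 : left_id 1 fl_scale.
Proof.
by elim/free_lie_ind=> x; rewrite !flE; apply/free_lie_eq => A f /=; rewrite scale1r.
Qed.

Lemma fl_scaleDr : right_distributive fl_scale +%R.
Proof.
move=> a; elim/free_lie_ind=> x; elim/free_lie_ind=> y.
by rewrite /GRing.add /= !flE; apply/free_lie_eq => A f /=; rewrite scalerDr.
Qed.

Lemma fl_scaleDl v : {morph fl_scale^~ v : a b / a + b}.
Proof.
move=> a b; elim/free_lie_ind: v => x; rewrite [RHS]/GRing.add /= !flE.
by apply/free_lie_eq => A f /=; rewrite scalerDl.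
Qed.

HB.instance Definition _ := GRing.Zmodule_isLmodule.Build K free_lie
  fl_scaleA fl_scale1 fl_scaleDr fl_scaleDl.

Lemma fl_lieDl (x y z : free_lie) : fl_lie (x + y) z = fl_lie x z + fl_lie y z.
Proof.
elim/free_lie_ind: x => x; elim/free_lie_ind: y => y; elim/free_lie_ind: z => z.
by rewrite /GRing.add /= !flE; apply/free_lie_eq => A f /=; rewrite lieDl.
Qed.

Lemma fl_lieZl (a : K) (x z : free_lie) : fl_lie (a *: x) z = a *: fl_lie x z.
Proof.
elim/free_lie_ind: x => x; elim/free_lie_ind: z => z.
by rewrite /GRing.scale /= !flE; apply/free_lie_eq => A f /=; rewrite lieZl.
Qed.

Lemma fl_lieDr (x y z : free_lie) : fl_lie z (x + y) = fl_lie z x + fl_lie z y.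
Proof.
elim/free_lie_ind: x => x; elim/free_lie_ind: y => y; elim/free_lie_ind: z => z.
by rewrite /GRing.add /= !flE; apply/free_lie_eq => A f /=; rewrite lieDr.
Qed.

Lemma fl_lieZr (a : K) (x z : free_lie) : fl_lie z (a *: x) = a *: fl_lie z x.
Proof.
elim/free_lie_ind: x => x; elim/free_lie_ind: z => z.
by rewrite /GRing.scale /= !flE; apply/free_lie_eq => A f /=; rewrite lieZr.
Qed.

Lemma fl_liexx (x : free_lie) : fl_lie x x = 0.
Proof.
elim/free_lie_ind: x => x; rewrite !flE.
by apply/free_lie_eq => A f /=; rewrite liexx.
Qed.

Lemma fl_jacobi (x y z : free_lie) :
  fl_lie (fl_lie x y) z + fl_lie (fl_lie y z) x + fl_lie (fl_lie z x) y = 0.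
Proof.
elim/free_lie_ind: x => x; elim/free_lie_ind: y => y; elim/free_lie_ind: z => z.
by rewrite /GRing.add /= !flE; apply/free_lie_eq => A f /=; rewrite lie_jacobi.
Qed.

HB.instance Definition _ := isLieAlgebra.Build K free_lie
  fl_lieDl fl_lieZl fl_lieDr fl_lieZr fl_liexx fl_jacobi.

Definition free_lie_var (i : 'I_n) : free_lie := free_lie_pi (LVar i).

Definition free_lie_ext (A : lieAlgType K) (f : 'I_n -> A) (a : free_lie) : A :=
  leval f (repr a).

Lemma free_lie_ext_var (A : lieAlgType K) (f : 'I_n -> A) i :
  free_lie_ext f (free_lie_var i) = f i.
Proof. exact: leval_repr. Qed.

Lemma free_lie_ext_morphism (A : lieAlgType K) (f : 'I_n -> A) :
  lie_morphism (free_lie_ext f).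
Proof.
by split=> *; rewrite /free_lie_ext leval_repr.
Qed.

Lemma free_lie_ext_unique (A : lieAlgType K) (g h : free_lie -> A) :
  lie_morphism g -> lie_morphism h ->
  (forall i, g (free_lie_var i) = h (free_lie_var i)) -> g =1 h.
Proof.
move=> [gD gZ gL] [hD hZ hL] gh; elim/free_lie_ind.
elim=> [i||s IH|s IHs t IHt|a s IHs|s IHs t IHt] //.
- exact: gh.
- have -> : free_lie_pi LZero = 0 *: (0 : free_lie) by rewrite scale0r.
  by rewrite gZ hZ !scale0r.
- have -> : free_lie_pi (LOpp s) = - free_lie_pi s by rewrite -fl_oppE.
  by rewrite -scaleN1r gZ hZ IH.
- have -> : free_lie_pi (LAdd s t) = free_lie_pi s + free_lie_pi t.
    by rewrite -fl_addE.
  by rewrite gD hD IHs IHt.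
- have -> : free_lie_pi (LScale a s) = a *: free_lie_pi s by rewrite -fl_scaleE.
  by rewrite gZ hZ IHs.
- have -> : free_lie_pi (LLie s t) = lie (free_lie_pi s) (free_lie_pi t).
    by rewrite -fl_lieE.
  by rewrite gL hL IHs IHt.
Qed.

End FreeLie.

Section FreeMetabelian.
Variables (K : fieldType) (n : nat).

Definition derived2_ideal : lie_ideal (free_lie K n) :=
  LieIdeal (lspan0 _) (@lspanD _ _ _) (@lspanZ _ _ _)
    (@derived2_lie _ (free_lie K n)).

Definition free_metab : lieAlgType K := lie_quot derived2_ideal.

Definition xgen (i : 'I_n) : free_metab :=
  lie_quot_pi derived2_ideal (free_lie_var K i).

(* The homomorphism from F_n to a metabelian Lie algebra A sending x_i to f i;
   see [metab_ext_morphism] below. *)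
Definition metab_ext (A : lieAlgType K) (f : 'I_n -> A) (a : free_metab) : A :=
  free_lie_ext f (repr (a : lie_quot derived2_ideal)).

Lemma free_metab_metabelian : metabelian free_metab.
Proof.
have [_ _ piL] := lie_quot_pi_morphism derived2_ideal.
elim/lie_quot_ind=> x; elim/lie_quot_ind=> y.
elim/lie_quot_ind=> z; elim/lie_quot_ind=> t.
transitivity (lie_quot_pi derived2_ideal (lie (lie x y) (lie z t))).
  by rewrite !piL.
apply/lie_quot_eq; rewrite subr0.
by apply: lspan_sub; exists (lie x y), (lie z t); split=> //; apply: derived_lie.
Qed.

Lemma metab_ext_pi (A : lieAlgType K) (f : 'I_n -> A) (a : free_lie K n) :
  metabelian A ->
  metab_ext f (lie_quot_pi derived2_ideal a) = free_lie_ext f a.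
Proof.
move=> Am; have [gD gZ gL] := free_lie_ext_morphism f.
have g0 : free_lie_ext f 0 = 0 by rewrite -[X in free_lie_ext f X](scale0r 0) gZ scale0r.
set b := repr (lie_quot_pi derived2_ideal a).
have : derived2_ideal (b - a) by apply/lie_quot_eq; rewrite lie_quot_repr.
suff ker c : derived2 _ c -> free_lie_ext f c = 0.
  by move=> /ker; rewrite gD -scaleN1r gZ scaleN1r => /eqP; rewrite subr_eq0 => /eqP.
apply: (lspan_ind (P := fun c => free_lie_ext f c = 0)) => //.
  by move=> x y gx gy; rewrite gD gx gy addr0.
move=> c0 _ [x [y [Dx Dy ->]]]; rewrite gZ gL.
suff -> : lie (free_lie_ext f x) (free_lie_ext f y) = 0 by rewrite scaler0.
move: x Dx; apply: lspan_ind.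
- by rewrite g0 lie0l.
- by move=> u v hu hv; rewrite gD lieDl hu hv addr0.
move=> c1 _ [u [v [_ _ ->]]]; rewrite gZ lieZl gL.
suff -> : lie (lie (free_lie_ext f u) (free_lie_ext f v)) (free_lie_ext f y) = 0.
  by rewrite scaler0.
move: y Dy; apply: lspan_ind.
- by rewrite g0 lie0r.
- by move=> p q hp hq; rewrite gD lieDr hp hq addr0.
by move=> c2 _ [p [q [_ _ ->]]]; rewrite gZ lieZr gL Am scaler0.
Qed.

Lemma metab_ext_xgen (A : lieAlgType K) (f : 'I_n -> A) i :
  metabelian A -> metab_ext f (xgen i) = f i.
Proof. by move=> Am; rewrite metab_ext_pi // free_lie_ext_var. Qed.

Lemma metab_ext_morphism (A : lieAlgType K) (f : 'I_n -> A) :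
  metabelian A -> lie_morphism (metab_ext f).
Proof.
move=> Am; have [gD gZ gL] := free_lie_ext_morphism f.
have [pD pZ pL] := lie_quot_pi_morphism derived2_ideal.
split.
- elim/lie_quot_ind=> x; elim/lie_quot_ind=> y.
  by rewrite -pD !metab_ext_pi.
- move=> c; elim/lie_quot_ind=> x.
  by rewrite -pZ !metab_ext_pi.
- elim/lie_quot_ind=> x; elim/lie_quot_ind=> y.
  by rewrite -pL !metab_ext_pi.
Qed.

Definition sym_act (s : 'S_n) : free_metab -> free_metab :=
  metab_ext (fun i => xgen (s i)).

Definition derived_invariants : set free_metab :=
  derived free_metab `&` [set f | forall s : 'S_n, sym_act s f = f].

(* The right action f p = f p(ad x_1, ..., ad x_n), where f (ad x) = [f, x].
   In a monomial ad x_1 is applied first, then ad x_2, and so on; on F_n'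
   these operators commute, so the order is immaterial there. *)
Definition ad_monomial (f : free_metab) (m : 'X_{1..n}) : free_metab :=
  foldl (fun g i => iter (m i) (fun g' => lie g' (xgen i)) g) f (enum 'I_n).

Definition ad_act (f : free_metab) (p : {mpoly K[n]}) : free_metab :=
  \sum_(m <- msupp p) p@_m *: ad_monomial f m.

(* The K[X_n]^{S_n}-submodule generated by G (G being a subset of F_n'). *)
Definition sym_span (G : set free_metab) : set free_metab :=
  [set f | exists r (g : 'I_r -> free_metab) (p : 'I_r -> {mpoly K[n]}),
     [/\ forall k, G (g k), forall k, p k \is symmetric
       & f = \sum_(k < r) ad_act (g k) (p k)]].

End FreeMetabelian.

Arguments derived_invariants : clear implicits.

Section Wreath.
Variables (K : fieldType) (n : nat).

(* W_n: the finite function w stands for \sum_i u_i (w i). *)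
Definition wmod := {ffun 'I_n -> {mpoly K[n]}}.
HB.instance Definition _ := GRing.Lmodule.on wmod.

Definition wmul (w : wmod) (p : {mpoly K[n]}) : wmod := [ffun i => w i * p].

Definition wreath := (wmod * {ffun 'I_n -> K^o})%type.
HB.instance Definition _ := GRing.Lmodule.on wreath.

Definition linear_form (v : {ffun 'I_n -> K^o}) : {mpoly K[n]} :=
  \sum_(j < n) (v j : K) *: 'X_j.

Definition wr_lie (a b : wreath) : wreath :=
  (wmul a.1 (linear_form b.2) - wmul b.1 (linear_form a.2), 0).

Lemma linear_formD v w : linear_form (v + w) = linear_form v + linear_form w.
Proof.
by rewrite -big_split; apply: eq_bigr => j _; rewrite ffunE scalerDl.
Qed.

Lemma linear_formZ c v : linear_form (c *: v) = c *: linear_form v.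
Proof.
by rewrite scaler_sumr; apply: eq_bigr => j _; rewrite ffunE scalerA.
Qed.

Lemma linear_form0 : linear_form 0 = 0.
Proof. by rewrite -[X in linear_form X](scale0r 0) linear_formZ scale0r. Qed.

Lemma wmodD (a b : wmod) i : (a + b) i = a i + b i.
Proof. exact: ffunE. Qed.

Lemma wmodN (a : wmod) i : (- a) i = - a i.
Proof. exact: ffunE. Qed.

Lemma wmodZ (c : K) (a : wmod) i : (c *: a) i = c *: a i.
Proof. exact: ffunE. Qed.

Lemma wmod0 i : (0 : wmod) i = 0.
Proof. exact: ffunE. Qed.

Lemma wmulE a p i : wmul a p i = a i * p.
Proof. exact: ffunE. Qed.

Let wmodE := (wmodD, wmodN, wmodZ, wmod0, wmulE).

Lemma wr_lieDl (x y z : wreath) : wr_lie (x + y) z = wr_lie x z + wr_lie y z.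
Proof.
congr pair; last by rewrite addr0.
apply/ffunP => i; rewrite !wmodE /= linear_formD mulrDl mulrDr opprD.
by rewrite addrACA.
Qed.

Lemma wr_lieZl (a : K) (x z : wreath) : wr_lie (a *: x) z = a *: wr_lie x z.
Proof.
congr pair; last by rewrite scaler0.
apply/ffunP => i; rewrite !wmodE /= linear_formZ.
by rewrite scalerBr -scalerAl -scalerAr.
Qed.

Lemma wr_lieN (x y : wreath) : wr_lie x y = - wr_lie y x.
Proof. by congr pair; rewrite ?oppr0 //= opprB. Qed.

Lemma wr_lieDr (x y z : wreath) : wr_lie z (x + y) = wr_lie z x + wr_lie z y.
Proof. by rewrite wr_lieN wr_lieDl opprD -!wr_lieN. Qed.

Lemma wr_lieZr (a : K) (x z : wreath) : wr_lie z (a *: x) = a *: wr_lie z x.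
Proof. by rewrite wr_lieN wr_lieZl -scalerN -wr_lieN. Qed.

Lemma wr_liexx (x : wreath) : wr_lie x x = 0.
Proof. by congr pair; rewrite subrr. Qed.

Lemma wr_jacobi (x y z : wreath) :
  wr_lie (wr_lie x y) z + wr_lie (wr_lie y z) x + wr_lie (wr_lie z x) y = 0.
Proof.
apply: injective_projections; last by rewrite /= !addr0.
apply/ffunP => i; rewrite /= !wmodE /= !linear_form0 !mulr0 !subr0.
set p := linear_form x.2; set q := linear_form y.2; set r := linear_form z.2.
ring.
Qed.

HB.instance Definition _ := isLieAlgebra.Build K wreath
  wr_lieDl wr_lieZl wr_lieDr wr_lieZr wr_liexx wr_jacobi.

Lemma wreath_metabelian : metabelian wreath.
Proof.
move=> x y z t; congr pair; apply/ffunP => i; rewrite !wmodE /=.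
by rewrite !linear_form0 !mulr0 subrr.
Qed.

Definition u_gen (i : 'I_n) : wreath := ([ffun k => (k == i)%:R], 0).
Definition v_gen (i : 'I_n) : wreath := (0, [ffun k => (k == i)%:R]).

Definition delta : free_metab K n -> wreath :=
  metab_ext (fun i => u_gen i + v_gen i).

Lemma delta_xgen i : delta (xgen K i) = u_gen i + v_gen i.
Proof. exact: metab_ext_xgen wreath_metabelian. Qed.

Lemma delta_morphism : lie_morphism delta.
Proof. exact: metab_ext_morphism wreath_metabelian. Qed.

(* [eps q] is \varepsilon_q(U_n, X_n) for q >= 1: its u_i-component is the
   elementary symmetric polynomial of degree q - 1 in the variables other
   than x_i. *)
Definition eps (q : nat) : wmod :=
  [ffun i => \sum_(J : {set 'I_n} | (#|J| == q.-1) && (i \notin J))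
               \prod_(j in J) 'X_j].

Definition hgen (i j : nat) : wmod :=
  wmul (eps i) (mesym n K j) *+ j - wmul (eps j) (mesym n K i) *+ i.

End Wreath.

(* Main.v *)
Require Import Defs.
From HB Require Import structures.
From mathcomp Require Import boolp classical_sets.
From mathcomp Require Import all_boot all_order all_algebra perm fingroup.
From mathcomp Require Import mpoly.
Set Implicit Arguments.
Unset Strict Implicit.
Unset Printing Implicit Defensive.
Import GRing.Theory.
Local Open Scope ring_scope.

(** Call w = (w_1, ..., w_n) in W_n closed when x_1 w_1 + ... + x_n w_n = 0.
    In characteristic zero the exterior derivative, divided by the degree,
    contracts the Koszul complex:
      w_k = \sum_j x_j (d_j (N w_k) - d_k (N w_j)),
    where N divides the monomial m by |m| + 1.  Hence the linear map
    T : w |-> \sum_(i, j) [x_i, x_j] d_j (N w_i) from W_n to F_n' is a right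
    inverse of delta on the closed elements, and the Jacobi identity shows that
    T (delta f) = f for f in F_n'.  So delta identifies F_n' with the closed
    elements of W_n.

    An S_n-invariant w is a combination of eps_1, ..., eps_n with symmetric
    coefficients s_q, and since \sum_i x_i (eps_q)_i = q e_q it is closed if and
    only if \sum_q q e_q s_q = 0.  As the e_q are algebraically independent
    generators of the symmetric polynomials, the Koszul contraction in the
    variables e_1, ..., e_n writes such a syzygy as a combination of the trivial
    ones, which correspond to the h_ij. *)

(** * Koszul complex and Euler operator *)

Section Koszul.
Variables (K : fieldType) (n : nat).
Implicit Types p q : {mpoly K[n]}.

(** For [c > 0] in characteristic zero, the inverse of [c] plus the Euler derivation \sum_i x_i d_i,
    which is diagonal on monomials. The N of the overview is [c = 1]; for [c = 0] the constant term
    goes to 0, as the inverse of 0 is 0. *)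
Definition euler_div (c : nat) p : {mpoly K[n]} :=
  \sum_(m <- msupp p) (p@_m / (mdeg m + c)%:R) *: 'X_[m].

Lemma mcoeff_euler_div c p m : (euler_div c p)@_m = p@_m / (mdeg m + c)%:R.
Proof.
rewrite raddf_sum /=; have [mp|/memN_msupp_eq0 pm0] := boolP (m \in msupp p).
  rewrite (bigD1_seq m) ?msupp_uniq //= mcoeffZ mcoeffX eqxx mulr1.
  rewrite big1 ?addr0 // => m' /negPf m'm.
  by rewrite mcoeffZ mcoeffX m'm mulr0.
rewrite pm0 mul0r big1_seq // => m' /= m'p.
rewrite mcoeffZ mcoeffX; case: eqVneq => [m'm|]; last by rewrite mulr0.
by rewrite m'm pm0 mul0r mul0r.
Qed.

Lemma euler_div_is_linear c : linear (euler_div c).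
Proof.
move=> a p q; apply/mpolyP => m.
by rewrite mcoeffD mcoeffZ !mcoeff_euler_div mcoeffD mcoeffZ mulrDl mulrA.
Qed.

HB.instance Definition _ c :=
  GRing.isLinear.Build K {mpoly K[n]} {mpoly K[n]} *:%R (euler_div c)
    (euler_div_is_linear c).

Lemma euler_divX c m : euler_div c 'X_[m] = (mdeg m + c)%:R^-1 *: 'X_[m].
Proof.
apply/mpolyP => m'; rewrite mcoeff_euler_div mcoeffZ mcoeffX mulrC.
by case: eqVneq => [->|] //; rewrite !mulr0.
Qed.

Lemma mulX_mderivX (i : 'I_n) m :
  'X_i * ('X_[m])^`M(i) = (m i)%:R *: 'X_[m] :> {mpoly K[n]}.
Proof.
rewrite mderivX -scalerAr -mpolyXD; case: (posnP (m i)) => [->|m_gt0].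
  by rewrite !scale0r.
by congr (_ *: 'X_[_]); rewrite addmC submK //; apply/mnm_lepP=> j;
  rewrite mnm1E; case: eqVneq => // <-.
Qed.

Lemma euler_mderivX m :
  \sum_i 'X_i * ('X_[m])^`M(i) = (mdeg m)%:R *: 'X_[m] :> {mpoly K[n]}.
Proof.
rewrite (eq_bigr _ (fun i _ => mulX_mderivX i m)) -scaler_suml mdegE.
by rewrite natr_sum.
Qed.

Hypothesis charK : [pchar K] =i pred0.

Lemma natrS_neq0 k : k.+1%:R != 0 :> K.
Proof. by rewrite ((pcharf0P K).1 charK). Qed.

Lemma euler_div1K p :
  \sum_i 'X_i * (euler_div 1 p)^`M(i) + euler_div 1 p = p.
Proof.
elim/mpolyind: p => [|c m p _ _ IH].
  by rewrite linear0 addr0 big1 // => i _; rewrite linear0 mulr0.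
rewrite linearD linearZ /= -[in RHS]IH.
under eq_bigr do rewrite linearD linearZ mulrDr -scalerAr /=.
rewrite big_split -scaler_sumr /= addrACA; congr (_ + _).
rewrite -scalerDr euler_divX; congr (_ *: _).
under eq_bigr do rewrite linearZ -scalerAr /=.
rewrite -scaler_sumr euler_mderivX -scalerDr -[X in _ + X]scale1r -scalerDl.
by rewrite scalerA addn1 natr1 mulVf ?scale1r ?natrS_neq0.
Qed.

(** Multiplication by x_i raises the degree by one, which absorbs the shift [1]. This carries N
    through a relation \sum_i x_i w_i = 0. *)
Lemma mulX_euler_div p i : 'X_i * euler_div 1 p = euler_div 0 ('X_i * p).
Proof.
elim/mpolyind: p => [|c m p _ _ IH]; first by rewrite mulr0 !linear0 mulr0.
rewrite mulrDr -scalerAr !linearD !linearZ /= mulrDr IH; congr (_ + _).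
rewrite -!scalerAr -mpolyXD !euler_divX -scalerAr -mpolyXD.
by rewrite mdegD mdeg1 addn0 addnC.
Qed.

(** By [mulX_euler_div] the relation also holds for the N w_j. Its derivative in x_k gives N w_k = -
    \sum_j x_j d_k (N w_j), which replaces the last term of [euler_div1K]. *)
Lemma koszul_exact (w : 'I_n -> {mpoly K[n]}) :
  \sum_i 'X_i * w i = 0 ->
  forall k, w k = \sum_j 'X_j *
    ((euler_div 1 (w k))^`M(j) - (euler_div 1 (w j))^`M(k)).
Proof.
move=> w0 k; under eq_bigr do rewrite mulrBr.
have D0 : \sum_j 'X_j * euler_div 1 (w j) = 0.
  under eq_bigr do rewrite mulX_euler_div.
  by rewrite -linear_sum w0 linear0.
have Ukk : (U_(k) - U_(k) = 0)%MM.
  by apply/mnmP => j; rewrite mnmBE subnn mnm0E.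
have := congr1 (mderiv k) D0; rewrite linear0 linear_sum /=.
under eq_bigr do rewrite mderivM mderivX mnm1E.
rewrite big_split /= (bigD1 k) //= eqxx scale1r Ukk mpolyX0 mul1r.
rewrite big1 ?addr0 => [|j /negPf jk]; last by rewrite jk scale0r mul0r.
move=> /eqP; rewrite addrC addr_eq0 => /eqP Dk.
by rewrite big_split /= sumrN Dk opprK euler_div1K.
Qed.

End Koszul.

(** * Invariants of W_n *)

Section Eps.
Variables (K : fieldType) (n : nat).
Implicit Types (p : {mpoly K[n]}) (w : 'I_n -> {mpoly K[n]}).

Lemma mulX_eps q (i : 'I_n) : (0 < q)%N ->
  'X_i * eps K n q i =
  \sum_(J : {set 'I_n} | (#|J| == q) && (i \in J)) \prod_(j in J) 'X_j.
Proof.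
case: q => // q _; rewrite ffunE mulr_sumr /=.
rewrite [RHS](reindex_onto (fun J => i |: J) (fun J => J :\ i)) /=; last first.
  by move=> J /andP[_ iJ]; rewrite setD1K.
apply: eq_big => [J|J /andP[_ iJ]]; last by rewrite big_setU1.
rewrite setU11 andbT cardsU1; have [iJ|iJ] := boolP (i \in J); last first.
  by rewrite setU1K // eqxx andbT add1n eqSS.
rewrite andbF; apply/esym/negbTE; rewrite negb_and orbC.
by apply/orP; left; apply/eqP => J'; rewrite -J' !inE eqxx in iJ.
Qed.

(** The sets of size [q.+1] are split according to whether they contain i. *)
Lemma mesym_eps q (i : 'I_n) :
  mesym n K q.+1 = eps K n q.+2 i + 'X_i * eps K n q.+1 i.
Proof.
rewrite mulX_eps // ffunE /mesym (bigID (fun J : {set 'I_n} => i \in J)) addrC /=.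
by congr (_ + _); apply: eq_bigl => J.
Qed.

(** Each J of size [q.+1] is counted once for each of its elements. *)
Lemma sum_mulX_eps q :
  \sum_i 'X_i * eps K n q.+1 i = mesym n K q.+1 *+ q.+1.
Proof.
under eq_bigr do rewrite mulX_eps //.
rewrite (exchange_big_dep (fun J : {set 'I_n} => #|J| == q.+1)) /=; last first.
  by move=> i J _ /andP[].
rewrite /mesym -sumrMnl; apply: eq_bigr => J /eqP cJ.
by rewrite cJ eqxx /= sumr_const cJ.
Qed.

Lemma eps1 i : eps K n 1 i = 1.
Proof.
rewrite ffunE (bigD1 set0) ?cards0 ?inE //= big_set0 big1 ?addr0 // => J.
by rewrite cards_eq0 => /andP[/andP[/eqP ->]]; rewrite eqxx.
Qed.

Lemma eps_geqn q i : (n <= q)%N -> eps K n q.+1 i = 0.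
Proof.
move=> nq; rewrite ffunE big1 // => J /andP[/eqP cJ /negP[]].
suff -> : J = setT by rewrite inE.
by apply/eqP; rewrite eqEcard subsetT cardsT card_ord cJ.
Qed.

Definition in_eps_span w := exists s : 'I_n -> {mpoly K[n]},
  (forall q, s q \is symmetric) /\
  forall i, w i = \sum_(q < n) eps K n q.+1 i * s q.

Lemma in_eps_span_ext w w' : w =1 w' -> in_eps_span w -> in_eps_span w'.
Proof. by move=> ww' [s [ss ws]]; exists s; split=> // i; rewrite -ww'. Qed.

Lemma in_eps_span0 : in_eps_span (fun=> 0).
Proof.
exists (fun=> 0); split=> [q|i]; first exact: rpred0.
by rewrite big1 // => q _; rewrite mulr0.
Qed.

Lemma in_eps_spanD w w' :
  in_eps_span w -> in_eps_span w' -> in_eps_span (fun i => w i + w' i).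
Proof.
move=> [s [ss ws]] [s' [ss' ws']]; exists (fun q => s q + s' q).
split=> [q|i]; first exact: rpredD.
by rewrite ws ws' -big_split; apply: eq_bigr => q _; rewrite mulrDr.
Qed.

Lemma in_eps_spanM w p :
  p \is symmetric -> in_eps_span w -> in_eps_span (fun i => w i * p).
Proof.
move=> sp [s [ss ws]]; exists (fun q => s q * p).
split=> [q|i]; first exact: rpredM.
by rewrite ws mulr_suml; apply: eq_bigr => q _; rewrite mulrA.
Qed.

Lemma in_eps_spanZ w c : in_eps_span w -> in_eps_span (fun i => c *: w i).
Proof.
move=> ws; apply: in_eps_span_ext (in_eps_spanM (p := c *: 1) _ ws) => [i|].
  by rewrite -scalerAr mulr1.
by rewrite rpredZ // rpred1.
Qed.

Lemma in_eps_span_sum (I : Type) (r : seq I) (P : pred I)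
    (F : I -> 'I_n -> {mpoly K[n]}) :
  (forall j, P j -> in_eps_span (F j)) ->
  in_eps_span (fun i => \sum_(j <- r | P j) F j i).
Proof.
move=> FP; elim: r => [|j r IH].
  by apply: in_eps_span_ext in_eps_span0 => i; rewrite big_nil.
have [Pj|/negPf Pj] := boolP (P j).
  apply: in_eps_span_ext (in_eps_spanD (FP j Pj) IH) => i.
  by rewrite big_cons Pj.
by apply: in_eps_span_ext IH => i; rewrite big_cons Pj.
Qed.

Lemma in_eps_span_eps q : in_eps_span (eps K n q.+1).
Proof.
have [nq|qn] := leqP n q.
  by apply: in_eps_span_ext in_eps_span0 => i; rewrite eps_geqn.
exists (fun k => (k == Ordinal qn)%:R); split=> [k|i].
  by case: eqP; rewrite ?rpred1 ?rpred0.
rewrite (bigD1 (Ordinal qn)) //= eqxx mulr1 big1 ?addr0 // => k /negPf kq.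
by rewrite kq mulr0.
Qed.

(** By [mesym_eps], x_i eps_q = e_q eps_1 - eps_{q+1} in the component i, and eps_{n+1} = 0 closes
    the recursion. *)
Lemma in_eps_spanX w : in_eps_span w -> in_eps_span (fun i => 'X_i * w i).
Proof.
move=> [s [ss ws]].
apply: (@in_eps_span_ext (fun i => \sum_(q < n)
    (eps K n 1 i * mesym n K q.+1 + -1 *: eps K n q.+2 i) * s q)) => [i|].
  rewrite ws mulr_sumr; apply: eq_bigr => q _.
  by rewrite eps1 mul1r (mesym_eps q i) scaleN1r mulrA addrC addKr.
apply: in_eps_span_sum => q _; apply: in_eps_spanM => //.
apply: in_eps_spanD; last exact/in_eps_spanZ/in_eps_span_eps.
by apply: in_eps_spanM; [apply: mesym_sym|apply: in_eps_span_eps].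
Qed.

(** The u_k-component of \sum_s s(u_i p), the sum of all S_n-translates of u_i p. *)
Definition orbit_sum (i : 'I_n) p (k : 'I_n) :=
  \sum_(s : 'S_n | s i == k) msym s p.

Lemma orbit_sum_sum (I : Type) (r : seq I) (F : I -> {mpoly K[n]}) i k :
  orbit_sum i (\sum_(j <- r) F j) k = \sum_(j <- r) orbit_sum i (F j) k.
Proof.
by rewrite exchange_big; apply: eq_bigr => s _; rewrite raddf_sum.
Qed.

Lemma orbit_sumZ i c p k : orbit_sum i (c *: p) k = c *: orbit_sum i p k.
Proof. by rewrite scaler_sumr; apply: eq_bigr => s _; rewrite msymZ. Qed.

Lemma orbit_sumM i p q k :
  q \is @symmetric n K -> orbit_sum i (p * q) k = orbit_sum i p k * q.
Proof.
move=> /issymP sq; rewrite mulr_suml; apply: eq_bigr => s _.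
by rewrite msymM sq.
Qed.

Lemma msymXi (s : 'S_n) i : msym s 'X_i = 'X_(s i) :> {mpoly K[n]}.
Proof.
rewrite msymX; congr 'X_[_]; apply/mnmP => j; rewrite mnmE !mnm1E.
by rewrite -(inj_eq (@perm_inj _ s)) permKV.
Qed.

Lemma orbit_sumX i p k : orbit_sum i ('X_i * p) k = 'X_k * orbit_sum i p k.
Proof.
rewrite mulr_sumr; apply: eq_bigr => s /eqP <-.
by rewrite msymM msymXi.
Qed.

(** Composition with t permutes the s such that s i = k. Hence the variables other than x_i may be
    renamed in p. *)
Lemma orbit_sum_msym i p k (t : 'S_n) :
  t i = i -> orbit_sum i (msym t p) k = orbit_sum i p k.
Proof.
move=> ti; rewrite [RHS](reindex_inj (mulgI t)) /=.
by apply: eq_big => [s|s _]; rewrite ?permM ?ti // msymMm.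
Qed.

Lemma orbit_sum1 i k : orbit_sum i 1 k = orbit_sum i 1 i.
Proof.
rewrite [LHS](reindex_inj (mulIg (tperm i k))) /=.
apply: eq_big => [s|s _]; last by rewrite !msym1.
by rewrite permM -[X in _ == X](tpermL i k) (inj_eq perm_inj).
Qed.

(** The orbit sum of 1 is a constant multiple of eps_1, and each further factor x_i acts as the
    diagonal multiplication of [in_eps_spanX]. *)
Lemma in_eps_span_orbit_sumXn i a : in_eps_span (orbit_sum i ('X_i ^+ a)).
Proof.
elim: a => [|a IH].
  apply: in_eps_span_ext (in_eps_spanM (p := orbit_sum i 1 i) _
    (in_eps_span_eps 0)) => [k|]; last first.
    by apply: rpred_sum => s _; rewrite msym1 rpred1.
  by rewrite eps1 mul1r orbit_sum1.
apply: in_eps_span_ext (in_eps_spanX IH) => k.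
by rewrite exprS orbit_sumX.
Qed.

Lemma sumXn_sym c : \sum_(k < n) 'X_k ^+ c \is @symmetric n K.
Proof.
apply/issymP => s; rewrite raddf_sum /= [RHS](reindex_inj (@perm_inj _ s)).
by apply: eq_bigr => k _; rewrite rmorphXn /= msymXi.
Qed.

Hypothesis charK : [pchar K] =i pred0.

(* Multiplying the orbit sum of a monomial with one variable x_l (l != i)
   deleted by the matching power sum yields a nonzero multiple of the full orbit
   sum, plus orbit sums of monomials in fewer variables. *)
Lemma in_eps_span_orbit_sum_monomial i m : in_eps_span (orbit_sum i 'X_[m]).
Proof.
(* The induction is on the number of variables other than x_i; powers of x_i alone are the base
   case. *)
pose supp (m : 'X_{1..n}) := [set k : 'I_n | (k != i) && (m k != 0%N)].
elim: {m}_.+1 {-2}m (ltnSn #|supp m|) => // N IH m; rewrite ltnS => supp_m.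
have [l l_m|m0] := pickP (fun k => k \in supp m); last first.
  suff -> : 'X_[m] = 'X_i ^+ m i :> {mpoly K[n]}.
    exact: in_eps_span_orbit_sumXn.
  rewrite mpolyXE_id (bigD1 i) //= big1 ?mulr1 // => k ki.
  by have := m0 k; rewrite inE ki => /negbFE /eqP ->.
have /andP[li ml] : (l != i) && (m l != 0%N) by rewrite inE in l_m.
pose c := m l; pose m' := (m - U_(l) *+ c)%MM.
have m'E k : m' k = if k == l then 0%N else m k.
  rewrite mnmBE mulmnE mnm1E (eq_sym l); case: eqP => [->|_]; last by rewrite mul0n subn0.
  by rewrite mul1n subnn.
have mE : m = (m' + U_(l) *+ c)%MM.
  apply/mnmP => k; rewrite mnmDE m'E mulmnE mnm1E (eq_sym l).
  by case: eqP => [->|_]; rewrite ?mul1n // mul0n addn0.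
(* For a new k, the transposition of k and l fixes i and turns m' x_k^c into m, so all new k
   contribute the same orbit sum. *)
pose new k := (k != i) && (m' k == 0%N).
have orbit_new k : new k ->
    orbit_sum i 'X_[m' + U_(k) *+ c] =1 orbit_sum i 'X_[m].
  move=> /andP[ki m'k] j; rewrite mE -(orbit_sum_msym 'X_[m' + _] j (t := tperm k l)).
    congr (orbit_sum i _ j); rewrite msymX; congr 'X_[_]; apply/mnmP => h.
    have m'l : m' l = 0%N by rewrite m'E eqxx.
    rewrite mnmE !mnmDE !mulmnE !mnm1E tpermV.
    case: tpermP => [->|->|/eqP hk /eqP hl]; rewrite ?eqxx ?m'l ?(eqP m'k) //.
      by rewrite eq_sym.
    by rewrite !(eq_sym _ h) (negPf hk) (negPf hl).
  by rewrite tpermD // eq_sym.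

have prod_psum j : orbit_sum i 'X_[m'] j * \sum_k 'X_k ^+ c
    = orbit_sum i 'X_[m] j *+ #|[set k | new k]|
      + \sum_(k | ~~ new k) orbit_sum i 'X_[m' + U_(k) *+ c] j.
  rewrite -orbit_sumM ?sumXn_sym // mulr_sumr orbit_sum_sum.
  under eq_bigr do rewrite mpolyXn -mpolyXD.
  rewrite (bigID new) /= (eq_bigr _ (fun k nk => orbit_new k nk j)).
  by rewrite sumr_const cardsE.
have nl : (0 < #|[set k | new k]|)%N.
  by apply/card_gt0P; exists l; rewrite inE /new li m'E eqxx.
have IH' m1 : supp m1 \subset supp m :\ l -> in_eps_span (orbit_sum i 'X_[m1]).
  move=> /subset_leq_card m1_le; apply: IH; apply: leq_trans supp_m.
  by apply: leq_ltn_trans m1_le _; rewrite [X in (_ < X)%N](cardsD1 l) l_m.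
(* For the other k, the factor x_k^c falls on x_i or on a variable already in m', so the support
   loses l and gains nothing. *)
have supp_old k : ~~ new k -> supp (m' + U_(k) *+ c)%MM \subset supp m :\ l.
  rewrite /new negb_and => old_k; apply/subsetP => h.
  rewrite !inE mnmDE mulmnE mnm1E m'E => /andP[hi]; rewrite hi.
  case: (eqVneq k h) old_k => [->|_ _]; last first.
    by rewrite mul0n addn0; case: (eqVneq h l).
  by rewrite hi m'E /=; case: (eqVneq h l).
pose rest j := \sum_(k | ~~ new k) orbit_sum i 'X_[m' + U_(k) *+ c] j.
(* The product formula is solved for the orbit sum of m: the number of new k is invertible because l
   is new and the characteristic is zero. *)
apply: (@in_eps_span_ext (fun j => (#|[set k | new k]|)%:R^-1 *:
    (orbit_sum i 'X_[m'] j * \sum_k 'X_k ^+ c + -1 *: rest j))) => [j|].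
  rewrite prod_psum scaleN1r addrK -scaler_nat scalerA mulVf ?scale1r //.
  by case: #|_| nl => // d _; apply: natrS_neq0.
apply/in_eps_spanZ/in_eps_spanD; last first.
  by apply/in_eps_spanZ/in_eps_span_sum => k /supp_old; apply: IH'.
apply: (in_eps_spanM (w := orbit_sum i 'X_[m']) (sumXn_sym _)).
apply: IH'; apply/subsetP => h; rewrite !inE m'E.
by case: (eqVneq h l); rewrite ?andbF.
Qed.

(** Averaging: n! w is the sum of the s(w), and grouping the terms of the component k by i = s^-1 k
    yields the orbit sums of the w_i. *)
Lemma msym_invariant_in_eps_span w :
  (forall s i, msym s (w i) = w (s i)) -> in_eps_span w.
Proof.
move=> w_inv.
apply: (@in_eps_span_ext (fun k => (n`!)%:R^-1 *:
    \sum_i \sum_(m <- msupp (w i)) (w i)@_m *: orbit_sum i 'X_[m] k)) => [k|].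
  have nf : (n`!)%:R != 0 :> K.
    by case: n`! (fact_gt0 n) => // d _; apply: natrS_neq0.
  apply: (scalerI nf); rewrite scalerA mulfV // scale1r.
  rewrite scaler_nat -card_Sn -sumr_const.
  rewrite [RHS](eq_bigl xpredT) => [|s]; last by rewrite inE.
  rewrite [RHS](partition_big (fun s : 'S_n => (s^-1)%g k) xpredT) //=.
  apply: eq_bigr => i _.
  transitivity (orbit_sum i (w i) k).
    rewrite [in RHS](mpolyE (w i)) orbit_sum_sum.
    by apply: eq_bigr => m _; rewrite orbit_sumZ.
  apply: eq_big => [s|s /eqP <-]; last by rewrite w_inv.
  by apply/eqP/eqP => <-; rewrite ?permK ?permKV.
apply/in_eps_spanZ/in_eps_span_sum => i _; apply: in_eps_span_sum => m _.
exact/in_eps_spanZ/in_eps_span_orbit_sum_monomial.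
Qed.

End Eps.

Lemma sum_split_lt (V : zmodType) n (F : 'I_n -> 'I_n -> V) :
  (forall i, F i i = 0) ->
  \sum_i \sum_j F i j = \sum_(i < n) \sum_(j < n | (i < j)%N) (F i j + F j i).
Proof.
move=> F0; under [RHS]eq_bigr do rewrite big_split.
rewrite big_split /= [X in _ + X]pair_big_dep /=.
rewrite [X in _ + X](reindex (fun p : 'I_n * 'I_n => (p.2, p.1))) /=; last first.
  by exists (fun p : 'I_n * 'I_n => (p.2, p.1)) => -[].
rewrite -(pair_big_dep xpredT (fun i j : 'I_n => (j < i)%N) (fun i j => F i j)) /=.
rewrite -big_split; apply: eq_bigr => i _ /=.
rewrite (bigID (fun j : 'I_n => (i < j)%N)) /=; congr (_ + _).
rewrite (bigD1 i) ?ltnn //= F0 add0r; apply: eq_bigl => j.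
by rewrite -leqNgt ltn_neqAle andbC.
Qed.

(** * Syzygies of the elementary symmetric polynomials *)

Section Syzygies.
Variables (K : fieldType) (n : nat).
Hypothesis charK : [pchar K] =i pred0.

Lemma hgen_span (w : 'I_n -> {mpoly K[n]}) :
  in_eps_span w -> \sum_i 'X_i * w i = 0 ->
  exists d : 'I_n -> 'I_n -> {mpoly K[n]},
    (forall q r, d q r \is symmetric) /\
    forall i, w i =
      \sum_(q < n) \sum_(r < n | (q < r)%N) hgen K n q.+1 r.+1 i * d q r.
Proof.
move=> [s [s_sym ws]] w0.
pose E := [tuple mesym n K i.+1 | i < n].
have XE i : 'X_i \mPo E = mesym n K i.+1 by
  rewrite comp_mpolyXU -tnth_nth tnth_mktuple.
have symE p : p \mPo E \is symmetric.
  by apply: mcomp_sym => i; rewrite -tnth_nth tnth_mktuple mesym_sym.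
(* The weight q + 1 in the relation \sum_q (q + 1) e_{q+1} s_q = 0 goes into [S q], so that the
   relation lifts along x_q |-> e_{q+1} to the one required by [koszul_exact]. *)
pose S q : {mpoly K[n]} := sval (sym_fundamental (s_sym q)) *+ q.+1.
have SE q : S q \mPo E = s q *+ q.+1.
  by rewrite /S raddfMn /=; case: sym_fundamental => /= t [->].
have S0 : \sum_q 'X_q * S q = 0.
  apply: msym_fundamental_un; rewrite raddf0 raddf_sum -[RHS]w0 /=.
  under eq_bigr do rewrite rmorphM /= XE SE.
  under [RHS]eq_bigr do rewrite ws mulr_sumr.
  rewrite exchange_big; apply: eq_bigr => q _ /=.
  under [RHS]eq_bigr do rewrite mulrA.
  by rewrite -mulr_suml sum_mulX_eps mulrnAr mulrnAl.
pose t q r : {mpoly K[n]} := (euler_div 1 (S q))^`M(r) - (euler_div 1 (S r))^`M(q).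
(* One inverse undoes the weight in [S q], the other compensates the weight r + 1 carried by
   [hgen]. *)
pose d (q r : 'I_n) : {mpoly K[n]} := (q.+1%:R^-1 * r.+1%:R^-1) *: (t q r \mPo E).
have dC q r : d r q = - d q r.
  rewrite /d mulrC -scalerN -raddfN /=; congr (_ *: (_ \mPo E)).
  by rewrite /t opprB.
have d0 q : d q q = 0 by rewrite /d /t subrr raddf0 scaler0.
exists d; split=> [q r|i]; first by rewrite rpredZ.
have sE q : s q = \sum_(r < n) mesym n K r.+1 *+ r.+1 * d q r.
  apply: (scalerI (natrS_neq0 charK q)); rewrite scaler_nat -SE.
  rewrite (koszul_exact charK S0) raddf_sum scaler_sumr; apply: eq_bigr => r _.
  rewrite -/(t q r) /= rmorphM /= XE mulrnAl -scaler_nat -scalerAr !scalerA.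
  by rewrite -invfM mulfV ?scale1r // mulf_neq0 ?natrS_neq0.
rewrite ws; under eq_bigr do rewrite sE mulr_sumr.
(* Since d is antisymmetric, the terms (q, r) and (r, q) combine into a multiple of a single
   [hgen]. *)
rewrite sum_split_lt => [|q]; last by rewrite d0 !mulr0.
apply: eq_bigr => q _; apply: eq_bigr => r _.
have hE : hgen K n q.+1 r.+1 i = eps K n q.+1 i * mesym n K r.+1 *+ r.+1
    - eps K n r.+1 i * mesym n K q.+1 *+ q.+1.
  by rewrite /hgen wmodD wmodN !ffunMnE !wmulE.
by rewrite hE (dC q r) !mulrN mulrBl -!mulrnAr !mulrA.
Qed.

End Syzygies.

(** * The commutator ideal of F_n *)

Local Open Scope classical_set_scope.

Section LieAlgebraTheory.
Variables (K : fieldType) (L : lieAlgType K).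
Implicit Types x y z f : L.

Lemma derivedD x y : derived L x -> derived L y -> derived L (x + y).
Proof. exact: lspanD. Qed.

Lemma derived_sum (I : Type) (r : seq I) (P : pred I) (F : I -> L) :
  (forall i, P i -> derived L (F i)) -> derived L (\sum_(i <- r | P i) F i).
Proof. exact: (big_ind (derived L) (lspan0 _) derivedD). Qed.

Lemma lspan_sub_lspan (S S' : set L) : S `<=` lspan S' -> lspan S `<=` lspan S'.
Proof.
move=> SS'; apply: lspan_ind; first exact: lspan0.
  by move=> x y; apply: lspanD.
by move=> a x /SS'; apply: lspanZ.
Qed.

Lemma lie_suml (I : Type) (r : seq I) (P : pred I) (F : I -> L) y :
  lie (\sum_(i <- r | P i) F i) y = \sum_(i <- r | P i) lie (F i) y.
Proof. exact: (big_morph (fun x => lie x y) (fun a b => lieDl a b y) (lie0l y)). Qed.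

Hypothesis Lm : metabelian L.

Lemma lie_derived_lie f x y : derived L f -> lie f (lie x y) = 0.
Proof.
apply: (lspan_ind (P := fun f => lie f (lie x y) = 0)).
- exact: lie0l.
- by move=> a b a0 b0; rewrite lieDl a0 b0 addr0.
- by move=> a _ [z [t [_ _ ->]]]; rewrite lieZl Lm scaler0.
Qed.

(** The two sides differ by [f, [x, y]], which vanishes in a metabelian algebra; so the operators ad
    x commute on L'. *)
Lemma lie_derivedAC f x y : derived L f -> lie (lie f x) y = lie (lie f y) x.
Proof. by move=> Df; rewrite lie_leibniz lie_derived_lie // addr0. Qed.

End LieAlgebraTheory.

(** * The polynomial action on F_n' and a spanning set of F_n' *)

Section FreeMetabelianTheory.
Variables (K : fieldType) (n : nat).
Notation F := (free_metab K n).
Notation x_ := (@xgen K n).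
Implicit Types (f g : F) (p : {mpoly K[n]}) (m : 'X_{1..n}).

Lemma free_metab_ind (P : F -> Prop) :
  P 0 -> (forall i, P (x_ i)) ->
  (forall f g, P f -> P g -> P (f + g)) -> (forall a f, P f -> P (a *: f)) ->
  (forall f g, P f -> P g -> P (lie f g)) -> forall f, P f.
Proof.
move=> P0 Px PD PZ PL; elim/lie_quot_ind; elim/free_lie_ind.
have [piD piZ piL] := lie_quot_pi_morphism (derived2_ideal K n).
elim=> [i||s IHs|s IHs t IHt|a s IHs|s IHs t IHt].
- exact: Px.
- exact: P0.
- have -> : free_lie_pi (LOpp s) = -1 *: free_lie_pi s.
    by rewrite scaleN1r -fl_oppE.
  by rewrite piZ; apply: PZ.
- have -> : free_lie_pi (LAdd s t) = free_lie_pi s + free_lie_pi t.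
    by rewrite -fl_addE.
  by rewrite piD; apply: PD.
- have -> : free_lie_pi (LScale a s) = a *: free_lie_pi s by rewrite -fl_scaleE.
  by rewrite piZ; apply: PZ.
- have -> : free_lie_pi (LLie s t) = lie (free_lie_pi s) (free_lie_pi t).
    by rewrite -fl_lieE.
  by rewrite piL; apply: PL.
Qed.

Let ad_step m f i := iter (m i) (fun g => lie g (x_ i)) f.
Let Fm := @free_metab_metabelian K n.

Lemma iter_ad_derived k f i :
  derived F f -> derived F (iter k (fun g => lie g (x_ i)) f).
Proof. by move=> Df; case: k => //= k; apply: derived_lie. Qed.

Lemma iter_ad_lie k f i y : derived F f ->
  iter k (fun g => lie g (x_ i)) (lie f y) =
  lie (iter k (fun g => lie g (x_ i)) f) y.
Proof.
move=> Df; elim: k => //= k ->.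
by rewrite lie_derivedAC //; apply: iter_ad_derived.
Qed.

Lemma foldl_ad_lie m s f y : derived F f ->
  foldl (ad_step m) (lie f y) s = lie (foldl (ad_step m) f s) y.
Proof.
elim: s f => //= i s IH f Df; rewrite /ad_step iter_ad_lie // IH //.
exact: iter_ad_derived.
Qed.

Lemma ad_monomial_lie f m y : derived F f ->
  ad_monomial (lie f y) m = lie (ad_monomial f m) y.
Proof. exact: foldl_ad_lie. Qed.

Lemma foldl_ad_notin m i s f : i \notin s ->
  foldl (ad_step (m + U_(i))%MM) f s = foldl (ad_step m) f s.
Proof.
elim: s f => //= k s IH f; rewrite inE negb_or => /andP[/negPf ik is'].
by rewrite IH // /ad_step mnmDE mnm1E ik addn0.
Qed.

(** The extra ad x_i acts at the place of i in the enumeration and is then moved past the later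
    operators by commutativity on F_n'. *)
Lemma ad_monomialDU f m i : derived F f ->
  ad_monomial f (m + U_(i))%MM = lie (ad_monomial f m) (x_ i).
Proof.
rewrite /ad_monomial -!/(ad_step _) => Df.
elim: (enum _) (mem_enum 'I_n i) (enum_uniq 'I_n) f Df => //= k s IH.
rewrite inE => + /andP[ks us] f Df; case: eqVneq => [->|ik] /= is'.
  rewrite foldl_ad_notin // {2}/ad_step mnmDE mnm1E eqxx addn1 /=.
  by rewrite foldl_ad_lie //; apply: iter_ad_derived.
rewrite IH //; last exact: iter_ad_derived.
by rewrite {2}/ad_step mnmDE mnm1E (negPf ik) addn0.
Qed.

Lemma ad_monomial0 f : ad_monomial f 0%MM = f.
Proof.
rewrite /ad_monomial; elim: (enum _) f => //= i s IH f.
by rewrite mnm0E /= IH.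
Qed.

Lemma ad_monomial_is_linear m : linear (fun f => ad_monomial f m).
Proof.
move=> a f g; rewrite /ad_monomial; elim: (enum _) f g => //= i s IH f g.
rewrite -IH; congr (foldl _ _ _); elim: (m i) => //= k ->.
by rewrite lieDl lieZl.
Qed.

Lemma ad_monomial_derived f m : derived F f -> derived F (ad_monomial f m).
Proof.
rewrite /ad_monomial; elim: (enum _) f => //= i s IH f Df.
by apply: IH; apply: iter_ad_derived.
Qed.

(** Allows several polynomials to be summed over one common list of monomials, as linearity in p
    requires. *)
Lemma ad_act_widen f p r : uniq r -> {subset msupp p <= r} ->
  ad_act f p = \sum_(m <- r) p@_m *: ad_monomial f m.
Proof.
move=> ur pr; rewrite (bigID (fun m => m \in msupp p)) /=.
rewrite [X in _ + X]big1 ?addr0 => [|m /memN_msupp_eq0 ->]; last first.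
  by rewrite scale0r.
rewrite -big_filter; apply: perm_big; apply: uniq_perm.
- exact: msupp_uniq.
- exact: filter_uniq.
by move=> m; rewrite mem_filter andb_idr // => /pr.
Qed.

Lemma ad_act_is_linear f : linear (ad_act f).
Proof.
move=> a p q; pose r := undup (msupp p ++ msupp q ++ msupp (a *: p + q)).
have ur : uniq r by apply: undup_uniq.
rewrite !(@ad_act_widen _ _ r) //; first last.
- by move=> m mp; rewrite mem_undup !mem_cat mp ?orbT.
- by move=> m mp; rewrite mem_undup !mem_cat mp ?orbT.
- by move=> m mp; rewrite mem_undup !mem_cat mp ?orbT.
rewrite scaler_sumr -big_split; apply: eq_bigr => m _ /=.
by rewrite mcoeffD mcoeffZ scalerDl scalerA.
Qed.

HB.instance Definition _ f :=
  GRing.isLinear.Build K {mpoly K[n]} F *:%R (ad_act f) (ad_act_is_linear f).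

Lemma ad_actX f m : ad_act f 'X_[m] = ad_monomial f m.
Proof. by rewrite /ad_act msuppX big_seq1 mcoeffX eqxx scale1r. Qed.

Lemma ad_actDl f g p : ad_act (f + g) p = ad_act f p + ad_act g p.
Proof.
rewrite -big_split; apply: eq_bigr => m _ /=.
have := ad_monomial_is_linear m 1 f g; rewrite !scale1r => ->.
exact: scalerDr.
Qed.

Lemma ad_act_oppl f p : ad_act (- f) p = - ad_act f p.
Proof.
have a0 : ad_act 0 p = 0.
  by apply: (addrI (ad_act 0 p)); rewrite -ad_actDl !addr0.
by apply/eqP; rewrite -addr_eq0 -ad_actDl addNr a0.
Qed.

Lemma ad_act_lie f p y : derived F f ->
  ad_act (lie f y) p = lie (ad_act f p) y.
Proof.
move=> Df; rewrite lie_suml; apply: eq_bigr => m _.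
by rewrite lieZl ad_monomial_lie.
Qed.

Lemma ad_actMX f p i : derived F f ->
  ad_act f ('X_i * p) = lie (ad_act f p) (x_ i).
Proof.
move=> Df; elim/mpolyind: p => [|c m p _ _ IH]; first by rewrite mulr0 !linear0 lie0l.
rewrite mulrDr -scalerAr !linearD !linearZ /= lieDl lieZl IH; congr (_ *: _ + _).
by rewrite -mpolyXD addmC !ad_actX ad_monomialDU.
Qed.

Lemma ad_act_derived f p : derived F f -> derived F (ad_act f p).
Proof.
move=> Df; apply: derived_sum => m _; apply: lspanZ.
exact: ad_monomial_derived.
Qed.

Definition commutator_monomials : set F :=
  [set f | exists i j m, f = ad_monomial (lie (x_ i) (x_ j)) m].

(** Induction on y: a generator lengthens the monomial, and a bracket acts by zero on F_n'. *)
Lemma lie_commutator_span f y : lspan commutator_monomials f ->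
  lspan commutator_monomials (lie f y).
Proof.
move=> Sf.
have Df : derived F f.
  move: Sf; apply: lspan_sub_lspan => _ [i [j [m ->]]].
  exact/ad_monomial_derived/derived_lie.
elim/free_metab_ind: y => [|i|y z|a y|y z _ _].
- by rewrite lie0r; apply: lspan0.
- move: f Sf {Df}; apply: lspan_ind; first by rewrite lie0l; apply: lspan0.
    by move=> f g Sf Sg; rewrite lieDl; apply: lspanD.
  move=> a _ [k [l [m ->]]]; rewrite lieZl; apply/lspanZ/lspan_sub.
  by exists k, l, (m + U_(i))%MM; rewrite ad_monomialDU //; apply: derived_lie.
- by rewrite lieDr; apply: lspanD.
- by rewrite lieZr; apply: lspanZ.
- by rewrite lie_derived_lie //; apply: lspan0.
Qed.

Lemma derived_commutator_span f : derived F f -> lspan commutator_monomials f.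
Proof.
apply: lspan_sub_lspan => {f} _ [f [g [_ _ ->]]].
elim/free_metab_ind: f g => [|i|f h IHf IHh|a f IHf|f h IHf _] g.
- by rewrite lie0l; apply: lspan0.
- elim/free_metab_ind: g => [|j|g h|a g|g h IHg IHh].
  + by rewrite lie0r; apply: lspan0.
  + by apply: lspan_sub; exists i, j, 0%MM; rewrite ad_monomial0.
  + by rewrite lieDr; apply: lspanD.
  + by rewrite lieZr; apply: lspanZ.
  (* The Jacobi identity moves x_i into an inner bracket with g or h alone, where the induction
     hypotheses apply. *)
  have -> : lie (x_ i) (lie g h) = lie (lie (x_ i) g) h - lie (lie (x_ i) h) g.
    by rewrite (lie_leibniz _ g h) [X in X - _]addrC addrK.
  apply: lspanD; first exact: lie_commutator_span.
  by rewrite -scaleN1r; apply/lspanZ/lie_commutator_span.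
- by rewrite lieDl; apply: lspanD.
- by rewrite lieZl; apply: lspanZ.
- exact/lie_commutator_span/IHf.
Qed.

End FreeMetabelianTheory.

(** * The map delta on F_n' and its inverse T *)

Section Embedding.
Variables (K : fieldType) (n : nat).
Notation F := (free_metab K n).
Notation x_ := (@xgen K n).
Notation delta := (@delta K n).
Implicit Types (f g : F) (p : {mpoly K[n]}) (m : 'X_{1..n}).

Lemma delta_is_linear : linear delta.
Proof. by have [dD dZ _] := delta_morphism K n; move=> a f g; rewrite dD dZ. Qed.

HB.instance Definition _ :=
  GRing.isLinear.Build K F (wreath K n) *:%R delta delta_is_linear.

Lemma delta_lie f g : delta (lie f g) = lie (delta f) (delta g).
Proof. by have [_ _ ->] := delta_morphism K n. Qed.

Lemma delta_sum (I : Type) (r : seq I) (P : pred I) (H : I -> F) k :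
  (delta (\sum_(i <- r | P i) H i)).1 k =
  \sum_(i <- r | P i) (delta (H i)).1 k.
Proof. by rewrite linear_sum raddf_sum sum_ffunE. Qed.

Lemma linear_form_v_gen (i : 'I_n) :
  linear_form (u_gen K i + v_gen K i).2 = 'X_i.
Proof.
rewrite /linear_form (bigD1 i) //= !ffunE eqxx add0r scale1r big1 ?addr0 //.
by move=> j /negPf ji; rewrite !ffunE ji add0r scale0r.
Qed.

Lemma delta_lie_xgen f i : (delta f).2 = 0 ->
  delta (lie f (x_ i)) = (wmul (delta f).1 'X_i, 0).
Proof.
move=> f0; rewrite delta_lie delta_xgen; congr pair.
apply/ffunP => k; rewrite /= wmodD wmodN !wmulE f0 linear_form0 mulr0 subr0.
by rewrite linear_form_v_gen.
Qed.

Lemma delta_commutator i j k :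
  (delta (lie (x_ i) (x_ j))).1 k = (k == i)%:R * 'X_j - (k == j)%:R * 'X_i.
Proof.
rewrite delta_lie !delta_xgen wmodD wmodN !wmulE !linear_form_v_gen.
by rewrite !wmodD !ffunE !addr0.
Qed.

Lemma delta_derived f : derived F f -> (delta f).2 = 0.
Proof.
apply: (lspan_ind (P := fun f => (delta f).2 = 0)).
- by rewrite linear0.
- by move=> g h g0 h0; rewrite linearD /= g0 h0 addr0.
- by move=> a _ [g [h [_ _ ->]]]; rewrite linearZ /= delta_lie scaler0.
Qed.

Lemma mnm_ind (P : 'X_{1..n} -> Prop) :
  P 0%MM -> (forall i m, P m -> P (m + U_(i))%MM) -> forall m, P m.
Proof.
move=> P0 PU m; elim: {m}(mdeg m) {-2}m (erefl (mdeg m)) => [m /eqP|d IH m dm].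
  by rewrite mdeg_eq0 => /eqP ->.
have [i mi|m0] := pickP (fun i => m i != 0%N); last first.
  suff -> : m = 0%MM by [].
  by apply/mnmP => i; have /negbFE/eqP -> := m0 i; rewrite mnm0E.
have mE : (m - U_(i) + U_(i) = m)%MM.
  by apply: submK; apply/mnm_lepP => j; rewrite mnm1E; case: (eqVneq i j) => // <-;
    rewrite lt0n.
rewrite -mE; apply/PU/IH; apply/eqP.
by rewrite -eqSS -dm -[in X in _ == X]mE mdegD mdeg1 addn1.
Qed.

Lemma delta_ad_act f p k : derived F f ->
  (delta (ad_act f p)).1 k = (delta f).1 k * p.
Proof.
move=> Df.
elim/mpolyind: p => [|c m p _ _ IH]; first by rewrite !linear0 mulr0 wmod0.
rewrite !linearD !linearZ /= wmodD wmodZ IH mulrDr -scalerAr ad_actX.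
congr (_ *: _ + _); clear IH; elim/mnm_ind: m k => [|i m IHm] k.
  by rewrite ad_monomial0 mpolyX0 mulr1.
have Dm := ad_monomial_derived m Df.
rewrite ad_monomialDU // delta_lie_xgen ?delta_derived // wmulE IHm mpolyXD.
by rewrite mulrA.
Qed.

(** Both sides are linear and agree on the x_i; on a bracket the left side is a commutator of linear
    forms, hence 0. On F_n' the V-part is 0, so the image consists of closed elements. *)
Lemma sum_mulX_delta f : \sum_i 'X_i * (delta f).1 i = linear_form (delta f).2.
Proof.
elim/free_metab_ind: f => [|i|f g IHf IHg|a f IHf|f g IHf IHg].
- by rewrite linear0 linear_form0 big1 // => i _; rewrite wmod0 mulr0.
- rewrite delta_xgen linear_form_v_gen (bigD1 i) //= !ffunE eqxx addr0 mulr1.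
  by rewrite big1 ?addr0 // => j /negPf ji; rewrite !ffunE ji mulr0.
- rewrite linearD /= linear_formD -IHf -IHg -big_split; apply: eq_bigr => i _.
  by rewrite /= wmodD mulrDr.
- rewrite linearZ /= linear_formZ -IHf scaler_sumr; apply: eq_bigr => i _.
  by rewrite /= wmodZ scalerAr.
- rewrite delta_lie /= linear_form0.
  under eq_bigr do rewrite wmodD wmodN !wmulE mulrBr !mulrA.
  by rewrite big_split sumrN /= -!mulr_suml IHf IHg mulrC subrr.
Qed.

(** The map T of the overview. *)
Definition koszul_lift (w : 'I_n -> {mpoly K[n]}) : F :=
  \sum_i \sum_j ad_act (lie (x_ i) (x_ j)) ((euler_div 1 (w i))^`M(j)).

Lemma koszul_lift_derived w : derived F (koszul_lift w).
Proof.
apply: derived_sum => i _; apply: derived_sum => j _.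
exact/ad_act_derived/derived_lie.
Qed.

Lemma sum_eq_mulrn (V : nmodType) (G : 'I_n -> V) i :
  \sum_k G k *+ (k == i) = G i.
Proof.
rewrite (bigD1 i) //= eqxx mulr1n big1 ?addr0 // => k /negPf ki.
by rewrite ki mulr0n.
Qed.

Lemma koszul_lift_is_linear a (w w' : wmod K n) :
  koszul_lift (a *: w + w') = a *: koszul_lift w + koszul_lift w'.
Proof.
rewrite scaler_sumr -big_split; apply: eq_bigr => i _ /=.
rewrite scaler_sumr -big_split; apply: eq_bigr => j _ /=.
by rewrite wmodD wmodZ !linearP.
Qed.

Hypothesis charK : [pchar K] =i pred0.

(** As delta [x_i, x_j] = u_i x_j - u_j x_i, the u_k-component of delta (T w) is the right side of
    [koszul_exact]. *)
Lemma delta_koszul_lift (w : 'I_n -> {mpoly K[n]}) k :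
  \sum_i 'X_i * w i = 0 -> (delta (koszul_lift w)).1 k = w k.
Proof.
move=> w0; rewrite [RHS](koszul_exact charK w0).
have -> : (delta (koszul_lift w)).1 k =
    \sum_i \sum_j ('X_j * (euler_div 1 (w i))^`M(j) *+ (i == k)
                  - 'X_i * (euler_div 1 (w i))^`M(j) *+ (j == k)).
  rewrite delta_sum; apply: eq_bigr => i _.
  rewrite delta_sum; apply: eq_bigr => j _.
  rewrite delta_ad_act; last exact: derived_lie.
  rewrite delta_commutator mulrBl -!mulrA !mulr_natl.
  by rewrite (eq_sym k i) (eq_sym k j).
under eq_bigr do rewrite big_split /= sumrN sum_eq_mulrn sumrMnl.
by rewrite big_split /= sum_eq_mulrn -big_split; apply: eq_bigr => j _;
  rewrite mulrBr.
Qed.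

Lemma koszul_lift_commutator a b m :
  koszul_lift (delta (ad_monomial (lie (x_ a) (x_ b)) m)).1
  = ad_monomial (lie (x_ a) (x_ b)) m.
Proof.
(* Here *)
have Dl i j : derived F (lie (x_ i) (x_ j)) by apply: derived_lie.
pose G i p : F := \sum_j ad_act (lie (x_ i) (x_ j)) (p^`M(j)).
have GE i j : G i ('X_j * 'X_[m]) = ad_act (lie (x_ i) (x_ j)) 'X_[m]
    + \sum_k ad_act (lie (lie (x_ i) (x_ k)) (x_ j)) ('X_[m])^`M(k).
  rewrite -(sum_eq_mulrn (fun k => ad_act (lie (x_ i) (x_ k)) 'X_[m])) -big_split.
  apply: eq_bigr => k _ /=; rewrite mderivM mderivX mnm1E linearD /=.
  rewrite (ad_actMX _ _ (Dl i k)) (ad_act_lie _ _ (Dl i k)) eq_sym; congr (_ + _).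
  case: eqP => [->|_]; last by rewrite scale0r mul0r linear0.
  have -> : (U_(j) - U_(j) = 0)%MM by apply/mnmP => l; rewrite mnmBE subnn mnm0E.
  by rewrite mpolyX0 scale1r mul1r.
(* [G i p] is T (u_i p) without the division by N. Of the factor |m| + 2, the 2 comes from the
   derivatives of x_b and x_a, and |m| from Euler's identity for m. *)
have GB : G a ('X_b * 'X_[m]) - G b ('X_a * 'X_[m])
    = (mdeg m).+2%:R *: ad_act (lie (x_ a) (x_ b)) 'X_[m].
  rewrite !GE opprD addrACA (lieC (x_ b) (x_ a)) ad_act_oppl opprK.
  (* The Jacobi identity turns [[x_a, x_k], x_b] - [[x_b, x_k], x_a] into [[x_a, x_b], x_k]. *)
  have -> : \sum_k ad_act (lie (lie (x_ a) (x_ k)) (x_ b)) ('X_[m])^`M(k)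
      - \sum_k ad_act (lie (lie (x_ b) (x_ k)) (x_ a)) ('X_[m])^`M(k)
      = ad_act (lie (x_ a) (x_ b)) (\sum_k 'X_k * ('X_[m])^`M(k)).
    rewrite -sumrB linear_sum; apply: eq_bigr => k _ /=.
    rewrite -ad_act_oppl -ad_actDl -lieC -lie_leibniz.
    by rewrite (ad_act_lie _ _ (Dl a b)) -(ad_actMX _ _ (Dl a b)).
  rewrite euler_mderivX linearZ /= -mulr2n -scaler_nat -scalerDl.
  by rewrite -natrD.
(* Both x_b m and x_a m have degree |m| + 1, so N divides them by the same c. *)
pose c : K := (mdeg m).+2%:R.
have c0 : c != 0 by apply: natrS_neq0.
apply: (scalerI c0); rewrite -[in RHS]ad_actX -GB.
rewrite /koszul_lift scaler_sumr.
rewrite -(sum_eq_mulrn (fun i => G i ('X_b * 'X_[m])) a).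
rewrite -(sum_eq_mulrn (fun i => G i ('X_a * 'X_[m])) b) -sumrN -big_split.
apply: eq_bigr => i _ /=; rewrite scaler_sumr -!sumrMnl -sumrN -big_split.
apply: eq_bigr => j _ /=.
rewrite -ad_actX (delta_ad_act _ _ (Dl a b)) delta_commutator mulrBl -!mulrA !mulr_natl.
rewrite linearB !raddfMn /= -!mpolyXD !euler_divX !mdegD !mdeg1 add1n addn1.
rewrite -scalerN !scalerMnr -scalerDr -/c mderivZ linearZ /= scalerA mulfV // scale1r.
by rewrite !linearD !raddfMn !raddfN.
Qed.

Lemma delta_derivedK f : derived F f -> koszul_lift (delta f).1 = f.
Proof.
move=> /derived_commutator_span.
have lift0 : koszul_lift (0 : wmod K n) = 0.
  have := koszul_lift_is_linear (-1) 0 0.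
  by rewrite scaleN1r oppr0 addr0 scaleN1r addNr.
apply: (lspan_ind (P := fun f => koszul_lift (delta f).1 = f)).
- by rewrite linear0.
- move=> g h gK hK; have := koszul_lift_is_linear 1 (delta g).1 (delta h).1.
  by rewrite !scale1r gK hK linearD.
- move=> a _ [i [j [m ->]]]; set g := ad_monomial _ _.
  have := koszul_lift_is_linear a (delta g).1 0.
  by rewrite !addr0 lift0 addr0 koszul_lift_commutator linearZ.
Qed.

Lemma delta_derived_inj f g : derived F f -> derived F g ->
  (delta f).1 = (delta g).1 -> f = g.
Proof. by move=> /delta_derivedK fK /delta_derivedK gK fg; rewrite -fK fg. Qed.

End Embedding.


(** * Equivariance of delta and invariants of F_n' *)

Section SymmetricAction.
Variables (K : fieldType) (n : nat).
Notation F := (free_metab K n).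
Notation delta := (@delta K n).
Implicit Types (f g : F) (s : 'S_n).

Lemma sym_act_morphism s : lie_morphism (@sym_act K n s).
Proof. exact/metab_ext_morphism/free_metab_metabelian. Qed.

Lemma sym_act_derived s f : derived F f -> derived F (sym_act s f).
Proof.
have [sD sZ sL] := sym_act_morphism s.
apply: (lspan_ind (P := fun f => derived F (sym_act s f))).
- by rewrite -(scale0r 0) sZ scale0r; apply: lspan0.
- by move=> g h; rewrite sD; apply: lspanD.
- by move=> a _ [g [h [_ _ ->]]]; rewrite sZ sL; apply/lspanZ/derived_lie.
Qed.

(** The V-part is carried along because the induction runs over all of F_n, and its bracket case
    needs the linear forms. *)
Lemma delta_sym_act s f :
  (forall k, (delta (sym_act s f)).1 (s k) = msym s ((delta f).1 k)) /\
  (forall k, (delta (sym_act s f)).2 (s k) = (delta f).2 k).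
Proof.
have [sD sZ sL] := sym_act_morphism s.
elim/free_metab_ind: f => [|i|f g [f1 f2] [g1 g2]|a f [f1 f2]|f g [f1 f2] [g1 g2]].
- rewrite -[X in sym_act s X](scale0r 0) sZ scale0r linear0.
  by split=> k; rewrite !ffunE ?msym0.
- rewrite /sym_act metab_ext_xgen ?delta_xgen; last exact: free_metab_metabelian.
  split=> k; rewrite !ffunE (inj_eq perm_inj) // !addr0.
  by case: eqP; rewrite ?msym1 ?msym0.
- rewrite sD !linearD; split=> k; first by rewrite !wmodD f1 g1 msymD.
  by rewrite ffunE f2 g2 [RHS]ffunE.
- rewrite sZ !linearZ; split=> k; first by rewrite !wmodZ f1 msymZ.
  by rewrite ffunE f2 [RHS]ffunE.
- have linE (h : F) : (forall k, (delta (sym_act s h)).2 (s k) = (delta h).2 k) ->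
      linear_form (delta (sym_act s h)).2 = msym s (linear_form (delta h).2).
    move=> h2; rewrite raddf_sum /linear_form (reindex_inj (@perm_inj _ s)) /=.
    by apply: eq_bigr => k _; rewrite h2 msymZ msymXi.
  rewrite sL !delta_lie; split=> k; last by rewrite !ffunE.
  by rewrite /= !(wmodD, wmodN, wmulE) f1 g1 !linE // msymB !msymM.
Qed.

Lemma sym_span_sum (G : set F) (I : Type) (r : seq I) (P : pred I) (H : I -> F) :
  (forall i, P i -> sym_span G (H i)) -> sym_span G (\sum_(i <- r | P i) H i).
Proof.
apply: big_ind.
- by exists 0%N, (fun=> 0), (fun=> 0); split=> [[]|[]|] //; rewrite big_ord0.
move=> _ _ [k [g [p [Gg sp ->]]]] [l [h [q [Gh sq ->]]]].
exists (k + l)%N, (fun i => match split i with inl j => g j | inr j => h j end),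
  (fun i => match split i with inl j => p j | inr j => q j end).
split=> [i|i|]; [by case: split|by case: split|].
rewrite big_split_ord /=; congr (_ + _); apply: eq_bigr => i _.
  by rewrite (unsplitK (inl i)).
by rewrite (unsplitK (inr i)).
Qed.

(** By [sum_mulX_eps] both terms of the difference become the same multiple of e_{i+1} e_{j+1}. *)
Lemma sum_mulX_hgen i j : \sum_k 'X_k * hgen K n i.+1 j.+1 k = 0.
Proof.
have hE k : 'X_k * hgen K n i.+1 j.+1 k =
    'X_k * eps K n i.+1 k * (mesym n K j.+1 *+ j.+1)
    - 'X_k * eps K n j.+1 k * (mesym n K i.+1 *+ i.+1).
  by rewrite /hgen wmodD wmodN !ffunMnE !wmulE -!mulrnAr mulrBr !mulrA.
under eq_bigr do rewrite hE.
rewrite big_split sumrN /= -!mulr_suml !sum_mulX_eps.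
by rewrite [X in _ - X]mulrC subrr.
Qed.

Lemma msym_eps s q k : msym s (eps K n q k) = eps K n q (s k).
Proof.
rewrite !ffunE raddf_sum /=.
rewrite [RHS](reindex_inj (imset_inj (@perm_inj _ s))) /=.
apply: eq_big => [J|J _]; first by rewrite (card_imset _ perm_inj) (mem_imset _ _ perm_inj).
rewrite rmorph_prod big_imset /=; last by move=> ? ? _ _; apply: perm_inj.
by apply: eq_bigr => j _; rewrite msymXi.
Qed.

Lemma msym_hgen s i j k : msym s (hgen K n i j k) = hgen K n i j (s k).
Proof.
have sE q : msym s (mesym n K q) = mesym n K q by apply/issymP/mesym_sym.
by rewrite /hgen !(wmodD, wmodN, ffunMnE, wmulE) msymB !msymMn !msymM !sE !msym_eps.
Qed.

Hypothesis charK : [pchar K] =i pred0.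

(** Since delta is equivariant and injective on F_n', invariance can be tested in W_n. *)
Lemma derived_invariantsP f :
  derived F f ->
  derived_invariants K n f <->
  (forall s k, msym s ((delta f).1 k) = (delta f).1 (s k)).
Proof.
move=> Df; split=> [[_ f_inv] s k|f_inv].
  by have [<- _] := delta_sym_act s f; rewrite f_inv.
split=> // s; apply: delta_derived_inj => //; first exact: sym_act_derived.
apply/ffunP => k; have [/(_ (s^-1 k)%g) + _] := delta_sym_act s f.
by rewrite permKV => ->; rewrite f_inv permKV.
Qed.

End SymmetricAction.

Theorem theorem9 (K : fieldType) (n : nat)
    (charK : [pchar K] =i pred0) (n_ge2 : (2 <= n)%N) :
  exists h : nat -> nat -> free_metab K n,
    (forall i j : nat, (1 <= i)%N -> (i < j)%N -> (j <= n)%N ->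
       delta (h i j) = (hgen K n i j, 0)) /\
    derived_invariants K n =
      sym_span [set f | exists i j : nat,
        [/\ (1 <= i)%N, (i < j)%N, (j <= n)%N & f = h i j]].
Proof.
pose h i j := koszul_lift (hgen K n i j); exists h.
have Dh i j : derived _ (h i j) by apply: koszul_lift_derived.
have h1 i j k : (0 < i)%N -> (i < j)%N -> (delta (h i j)).1 k = hgen K n i j k.
  (* Positive indices matter: [eps 0] coincides with [eps 1], and [hgen] is closed only from index 1
     on. *)
  case: i j => [|i] [|j] // _ _.
  exact/(delta_koszul_lift charK)/sum_mulX_hgen.
split=> [i j i0 ij _|].
  apply: injective_projections; last exact: delta_derived.
  by apply/ffunP => k; rewrite h1.
apply/seteqP; split=> [f f_inv|f [r [g [p [Gg sp ->]]]]].
  have Df : derived _ f by case: f_inv.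
  have /(derived_invariantsP charK Df) w_inv := f_inv.
  have w0 : \sum_i 'X_i * (delta f).1 i = 0.
    by rewrite sum_mulX_delta delta_derived // linear_form0.
  have [d [d_sym wE]] :=
    hgen_span charK (msym_invariant_in_eps_span charK w_inv) w0.
  (* The coefficients of delta f in W_n are transported back to F_n' by injectivity of delta. *)
  have -> : f = \sum_(q < n) \sum_(r < n | (q < r)%N) ad_act (h q.+1 r.+1) (d q r).
    apply: (delta_derived_inj charK) => //.
      by apply: derived_sum => q _; apply: derived_sum => r _; apply: ad_act_derived.
    apply/ffunP => k; rewrite wE delta_sum; apply: eq_bigr => q _.
    by rewrite delta_sum; apply: eq_bigr => r qr; rewrite delta_ad_act // h1.
  apply: sym_span_sum => q _; apply: sym_span_sum => r qr.
  exists 1%N, (fun=> h q.+1 r.+1), (fun=> d q r); split=> //.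
    by move=> _; exists q.+1, r.+1.
  by rewrite big_ord1.
(* Conversely, each generator lies in F_n' and has an invariant image, and symmetric coefficients
   preserve both properties. *)
have Dg k : derived _ (g k) by have [i [j [_ _ _ ->]]] := Gg k.
apply/(derived_invariantsP charK).
  by apply: derived_sum => k _; apply: ad_act_derived.
move=> s i; rewrite !delta_sum raddf_sum; apply: eq_bigr => k _ /=.
rewrite !delta_ad_act //.
have [a [b [a0 ab _ ->]]] := Gg k.
by rewrite !h1 // msymM msym_hgen; have /issymP -> := sp k.
Qed.
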